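(* Let $p=n^{\delta-1}$ with $0<\delta<1$ fixed. Then for every $k$ there is an explicitly described algorithm, running in time $n^{O(1/(1-\delta))}$, such that for every adversarial planting strategy, when $G\sim AG(n,p,k)$ is generated with that strategy, the algorithm outputs a maximum clique of $G$ with probability tending to $1$ as $n\to\infty$ (over the choice of $G'\sim G(n,p)$).
   Context: $G(n,p)$ is the Erdős–Rényi random graph on $n$ vertices with edge probability $p$. The model $AG(n,p,k)$: sample $G'\sim G(n,p)$; a computationally unbounded adversary, as an arbitrary function of $G'$ (its strategy), selects a set $K$ of $k$ vertices; all missing edges inside $K$ are added, giving $G$. *)

(* Defs.v *)
From HB Require Import structures.
From mathcomp Require Import all_boot all_order all_algebra.
From mathcomp Require Import all_classical all_reals.
From mathcomp Require Import topology normedtype sequences exp.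
Set Implicit Arguments. Unset Strict Implicit. Unset Printing Implicit Defensive.
Import Order.TTheory GRing.Theory Num.Theory.

(* Tape alphabet: option bool (None = blank); one-way infinite tape indexed by
   nat; states 'I_(nQ).+1, start state ord0; a transition returning None
   means "halt".  Direction bit: true = right, false = left (stays at 0). *)
Record TM := MkTM {
  nQ : nat;
  tm_delta : 'I_nQ.+1 -> option bool -> option ('I_nQ.+1 * option bool * bool)
}.

Definition config (M : TM) := ('I_(nQ M).+1 * (nat -> option bool) * nat)%type.

Definition step (M : TM) (c : config M) : option (config M) :=
  let: (q, tp, h) := c in
  match tm_delta q (tp h) with
  | None => None
  | Some (q', s, d) =>
      Some (q', (fun i => if i == h then s else tp i), (if d then h.+1 else h.-1))
  end.

(* run M t c = Some cf  iff  M, started in c, halts in configuration cf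
   after fewer than t steps. *)
Fixpoint run (M : TM) (t : nat) (c : config M) : option (config M) :=
  match t with
  | 0 => None
  | t'.+1 => match step c with None => Some c | Some c' => run t' c' end
  end.

Definition init (M : TM) (w : seq bool) : config M :=
  (ord0, (fun i => if i < size w then Some (nth false w i) else None), 0).

Definition outputs (M : TM) (cf : config M) (w : seq bool) : Prop :=
  let: (_, tp, _) := cf in
  (forall i, i < size w -> tp i = Some (nth false w i)) /\ tp (size w) = None.

Definition enc_input (n k : nat) (adj : 'I_n -> 'I_n -> bool) : seq bool :=
  nseq k true ++ false :: flatten [seq [seq adj i j | j <- enum 'I_n] | i <- enum 'I_n].

Definition enc_set (n : nat) (S : {set 'I_n}) : seq bool := [seq i \in S | i <- enum 'I_n].

Definition upair (n : nat) := {x : 'I_n * 'I_n | (x.1 < x.2)%N}.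

Definition adj (n : nat) (E : {set upair n}) (i j : 'I_n) : bool :=
  [exists e : upair n, (e \in E) && ((val e == (i, j)) || (val e == (j, i)))].

Definition gnp_prob (R : realType) (n : nat) (p : R) (E : {set upair n}) : R :=
  \prod_(e : upair n) (if e \in E then p else 1 - p).

Definition planted (n : nat) (E : {set upair n}) (K : {set 'I_n}) (i j : 'I_n) : bool :=
  adj E i j || [&& i != j, i \in K & j \in K].

Definition is_clique (n : nat) (g : 'I_n -> 'I_n -> bool) (S : {set 'I_n}) : Prop :=
  forall i j, i \in S -> j \in S -> i != j -> g i j.

Definition is_max_clique (n : nat) (g : 'I_n -> 'I_n -> bool) (S : {set 'I_n}) : Prop :=
  is_clique g S /\ forall T : {set 'I_n}, is_clique g T -> (#|T| <= #|S|)%N.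

Definition succeeds (M : TM) (n k : nat) (strat : {set upair n} -> {set 'I_n})
    (E : {set upair n}) : Prop :=
  exists t (cf : config M) (S : {set 'I_n}),
    run t (init M (enc_input k (planted E (strat E)))) = Some cf /\
    outputs cf (enc_set S) /\ is_max_clique (planted E (strat E)) S.

Definition success_prob (R : realType) (M : TM) (n k : nat) (p : R)
    (strat : {set upair n} -> {set 'I_n}) : R :=
  \sum_(E : {set upair n}) (if `[< succeeds M k strat E >] then gnp_prob p E else 0).

(* Main.v *)
(* Let r be about 3/(1 - delta).  By a union bound, G' almost surely contains no
   complete bipartite graph K_{r,r}.  Let T be a maximum clique of G, and let Q
   consist of r vertices of T inside K if there are that many, and of all of T
   otherwise.  Vertices outside K have only edges of G', so T has fewer than 2r
   vertices outside K, and fewer than r vertices outside K see all of an r-subset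
   of K; since |T| >= |K|, at most 3r vertices outside T are adjacent to all of Q.
   Calling their set W, T consists of Q and of the common neighbours of Q that
   are not in W.  So it suffices to try all pairs (Q, W) of 3r-tuples.

   This search is done by a two-way automaton with O(r) heads on the input, seen
   by its control only through the symbols under the heads and the order of the
   heads.  A Turing machine simulates it in place: the cells under heads are
   blanked, while their contents and the order of the heads are kept in the
   state, so that a head is found by walking over the blanks.  An automaton that
   halts without writing repeats no configuration, which bounds its running time
   by a polynomial of degree O(r).  The output overwrites only the prefix of the
   input holding k and the first row of the adjacency matrix, and this row is
   never read, as an edge is always looked up below the diagonal. *)
Require Import Defs.
From HB Require Import structures.
From mathcomp Require Import all_boot all_order all_algebra.
From mathcomp Require Import all_classical all_reals.
From mathcomp Require Import topology normedtype sequences exp.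
From mathcomp Require Import zify lra.
Set Implicit Arguments. Unset Strict Implicit. Unset Printing Implicit Defensive.
Import Order.TTheory GRing.Theory Num.Theory numFieldNormedType.Exports.

(** * Simulating a multihead automaton on one tape *)

Section FiniteTypeTM.

Variables (T : finType) (t0 : T).
Variable delta : T -> option bool -> option (T * option bool * bool).

Definition tconf := (T * (nat -> option bool) * nat)%type.

Definition tstep (c : tconf) : option tconf :=
  let: (q, tp, h) := c in
  match delta q (tp h) with
  | None => None
  | Some (q', s, d) =>
      Some (q', (fun i => if i == h then s else tp i), if d then h.+1 else h.-1)
  end.

Fixpoint titer (m : nat) (c : tconf) : option tconf :=
  if m is m'.+1 then if tstep c is Some c' then titer m' c' else None
  else Some c.

Lemma titerD m1 m2 c c1 : titer m1 c = Some c1 ->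
  titer (m1 + m2) c = titer m2 c1.
Proof.
elim: m1 c => [|m1 IH] c /=; first by case=> ->.
by case: (tstep c) => // c'; apply: IH.
Qed.

(** Putting [t0] in front of the enumeration gives it index 0, so that it becomes the start state
    [ord0]; its second copy is never produced by [tencode]. *)
Definition tdecode (i : 'I_(#|T|).+1) : T := nth t0 (t0 :: enum T) i.
Definition tencode (q : T) : 'I_(#|T|).+1 := inord (index q (t0 :: enum T)).

Lemma tencodeK : cancel tencode tdecode.
Proof.
move=> q; rewrite /tdecode /tencode inordK ?nth_index //.
  by rewrite inE mem_enum orbT.
have : index q (t0 :: enum T) < size (t0 :: enum T).
  by rewrite index_mem inE mem_enum orbT.
by rewrite /= -cardE.
Qed.

Definition tm_of : TM :=
  @MkTM #|T| (fun i s =>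
    omap (fun r : T * option bool * bool => (tencode r.1.1, r.1.2, r.2))
         (delta (tdecode i) s)).

Definition econf (c : tconf) : config tm_of := (tencode c.1.1, c.1.2, c.2).

Lemma step_tm_of c : step (econf c) = omap econf (tstep c).
Proof.
case: c => [[q tp] h]; rewrite /econf /step /= tencodeK.
by case: (delta q (tp h)) => [[[q' s] d]|].
Qed.

(** [run] needs one unit of fuel more than the number of steps, to see that no transition
    applies. *)
Lemma run_tm_of m c c1 : titer m c = Some c1 -> tstep c1 = None ->
  run m.+1 (econf c) = Some (econf c1).
Proof.
have runS t (cf : config tm_of) : run t.+1 cf =
    if step cf is Some cf' then run t cf' else Some cf by [].
elim: m c => [|m IH] c; rewrite runS step_tm_of /=.
  by case=> <- ->.
case: (tstep c) => //= c' c'1 c1N; exact: IH.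
Qed.

Lemma init_tm_of w : init tm_of w =
  econf (t0, (fun i => if i < size w then Some (nth false w i) else None), 0).
Proof.
rewrite /init /econf /tencode /=; congr (_, _, _).
by apply/val_inj; rewrite /= eqxx inordK.
Qed.

End FiniteTypeTM.

(** * Multihead automata: head positions, views and actions *)

Section Multihead.

Variable I : finType.

Implicit Types (i j k : I) (d : bool) (p : I -> nat) (tp : nat -> option bool).

Definition data := ((I -> nat) * (nat -> option bool))%type.

Definition view_t := ({ffun I * I -> bool} * {ffun I -> option bool})%type.

Definition view (s : data) : view_t :=
  ([ffun ij : I * I => s.1 ij.1 <= s.1 ij.2], [ffun i => s.2 (s.1 i)]).

Inductive act := Nop | Move of bool & I | Write of I & bool.

Lemma view1 s i j : (view s).1 (i, j) = (s.1 i <= s.1 j).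
Proof. by rewrite ffunE. Qed.

Lemma view2 s i : (view s).2 i = s.2 (s.1 i).
Proof. by rewrite ffunE. Qed.

Definition beyond (v : view_t) d i j := if d then ~~ v.1 (j, i) else ~~ v.1 (i, j).
Definition pbeyond p d i j := if d then p i < p j else p j < p i.

Lemma beyondE s d i j : beyond (view s) d i j = pbeyond s.1 d i j.
Proof. by case: d; rewrite /= ffunE /= ltnNge. Qed.

Definition enabled (v : view_t) (a : act) : bool :=
  match a with
  | Nop => false
  | Move d i => [exists j, beyond v d i j]
  | Write i _ => [exists j, beyond v true i j]
  end.

Definition shift d x := if d then x.+1 else x.-1.

Definition upd (A : eqType) B (f : A -> B) x y := fun z => if z == x then y else f z.

(* Moves never enlarge the interval spanned by the heads, and nothing is
   written under the rightmost head: otherwise the action is void. *)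
Definition mact (a : act) (s : data) : data :=
  if enabled (view s) a then
    match a with
    | Nop => s
    | Move d i => (upd s.1 i (shift d (s.1 i)), s.2)
    | Write i b => (s.1, upd s.2 (s.1 i) (Some b))
    end
  else s.

(** Under this invariant a blank met on the simulating tape to the left of some head can only be a
    hole, which is how heads are located. *)
Definition filled (s : data) := forall i x, x < s.1 i -> s.2 x != None.

Lemma filled_mact a s : filled s -> filled (mact a s).
Proof.
case: s => p tp F; rewrite /mact; case: ifP => // ; case: a => [//|d i|i b] /=.
  case/existsP => j; rewrite beyondE /= => ij k x /=; rewrite /upd.
  case: eqP => [_|_]; last exact: F.
  case: d ij => /= ij xi; first by apply: (F j) => /=; lia.
  by apply: (F i) => /=; lia.
by move=> _ k x /= xk; rewrite /upd; case: (x =P p i) => // _; apply: (F k).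
Qed.

(* Cells under heads are blanked ("holes"); their contents are kept in the
   finite control. *)
Definition real p tp : nat -> option bool :=
  fun x => if [exists j, p j == x] then None else tp x.

Lemma real_head p tp i : real p tp (p i) = None.
Proof. by rewrite /real; case: existsP => // -[]; exists i. Qed.

Definition nearest (v : view_t) d i j :=
  beyond v d i j && [forall k, beyond v d i k ==> ~~ beyond v d k j].

Lemma nearestP p tp d i j :
  reflect (pbeyond p d i j /\ forall k, pbeyond p d i k -> ~~ pbeyond p d k j)
          (nearest (view (p, tp)) d i j).
Proof.
apply: (iffP andP); rewrite beyondE => -[ij H]; split=> //.
  move=> k ik; move/forallP: H => /(_ k) /implyP.
  by rewrite !beyondE /=; apply.
apply/forallP => k; apply/implyP; rewrite !beyondE /=; exact: H.
Qed.

(* The symbol [s] read on arrival tells whether the nearest head in direction [d]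
   was exactly one cell away, which is all that is needed to update the order. *)
Definition mvview (v : view_t) i d (s : option bool) : view_t :=
  let hit j := (s == None) && nearest v d i j in
  ([ffun jk : I * I =>
      if jk.1 == i then
        if jk.2 == i then true
        else if d then beyond v true i jk.2
        else v.1 (i, jk.2) || hit jk.2
      else if jk.2 == i then
        if d then v.1 (jk.1, i) || hit jk.1
        else beyond v false i jk.1
      else v.1 jk],
   [ffun j => if j == i then
                if s is Some _ then s
                else if [pick k | nearest v d i k] is Some k then v.2 k else None
              else v.2 j]).

(** Inside the span of the heads the arrival cell is blank only if a head stands there, and then the
    nearest head does; conversely nothing fits between adjacent cells. *)
Lemma hitP p tp d i j : filled (p, tp) -> [exists j, beyond (view (p, tp)) d i j] ->
  (real p tp (shift d (p i)) == None) && nearest (view (p, tp)) d i j =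
  (p j == shift d (p i)).
Proof.
move=> F /existsP[j0]; rewrite beyondE /= => ij0.
have lti : d = false -> 0 < p i by case: d ij0 => //=; lia.
apply/idP/idP.
  case/andP => rN /nearestP[ij Hj].
  have [k /eqP kx] : exists k, p k == shift d (p i).
    apply/existsP; move: rN; rewrite /real; case: ifP => // + /eqP tN.
    move=> /existsPn noh.
    (* With no head on it, the arrival cell lies strictly left of [j0] on a right move and of [i] on
       a left move, hence is filled. *)
    have := F (if d then j0 else i) (shift d (p i)); rewrite /= tN.
    have := noh j0; case: d lti ij0 {Hj ij tN noh} => [/= _|/= /(_ erefl) ?] A B C.
      by apply: C; lia.
    by apply: C; lia.
  have ik : pbeyond p d i k.
    by case: d lti kx {ij0 rN ij Hj} => [/= _|/= /(_ erefl)]; lia.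
  have := Hj k ik; case: d lti kx {ij0 rN Hj ik} ij => [/= _|/= /(_ erefl)]; lia.
move=> /eqP jx; rewrite -jx real_head eqxx /=; apply/nearestP; split.
  by case: d lti jx {ij0} => [/= _|/= /(_ erefl)]; lia.
move=> k; case: d lti jx {ij0} => [/= _|/= /(_ erefl)]; lia.
Qed.

Lemma mvviewP p tp d i : filled (p, tp) -> [exists j, beyond (view (p, tp)) d i j] ->
  mvview (view (p, tp)) i d (real p tp (shift d (p i))) =
  view (upd p i (shift d (p i)), tp).
Proof.
move=> F en; have lti : d = false -> 0 < p i.
  by move: en => /existsP[j]; rewrite beyondE /=; case: d => //=; lia.
apply: injective_projections; apply/ffunP.
  case=> j k; rewrite [LHS]ffunE view1 !(hitP _ F en) !beyondE !view1 /= /upd.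
  have [_|ji] := eqVneq j i; have [_|ki] := eqVneq k i; first by rewrite leqnn.
  - case: d lti {en} => [_|/(_ erefl) i0] //=; apply/idP/idP; lia.
  - case: d lti {en} => [_|/(_ erefl) i0] /=; apply/idP/idP; lia.
  - by [].
move=> j; rewrite [LHS]ffunE [RHS]view2 [RHS]/= /upd.
have [_|ji] := eqVneq j i; last by rewrite view2.
case E: (real p tp (shift d (p i))) => [b|].
  by move: E; rewrite /real; case: ifP.
case: pickP => [k Hk|Hk].
  have := hitP k F en; rewrite E eqxx Hk andbT => /esym/eqP kx; by rewrite view2 /= kx.
have nohead k : p k != shift d (p i) by rewrite -(hitP k F en) Hk andbF.
move: E; rewrite /real; case: existsP => [[k kx]|_ ->//].
by have := nohead k; rewrite kx.
Qed.

(** Every head sharing the cell of [i], recognised by comparing both ways, must see the new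
    symbol. *)
Definition wrview (v : view_t) i b : view_t :=
  (v.1, [ffun j => if v.1 (i, j) && v.1 (j, i) then Some b else v.2 j]).

Lemma wrviewP p tp i b : wrview (view (p, tp)) i b = view (p, upd tp (p i) (Some b)).
Proof.
congr (_, _); apply/ffunP => j; rewrite !ffunE /= /upd.
by rewrite -eqn_leq eq_sym.
Qed.

Lemma nearest_exists p tp d i j : pbeyond p d i j ->
  exists k, nearest (view (p, tp)) d i k.
Proof.
move=> ij; pose m (k : I) := if d then p k else p i - p k.
case: (@arg_minnP _ j (pbeyond p d i) m ij) => k ik Hk; exists k.
apply/nearestP; split=> // l il; have := Hk l il.
by rewrite /m; case: d ij ik il {Hk m} => /=; lia.
Qed.

Definition next (v : view_t) d i := odflt i [pick j | nearest v d i j].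

Lemma nextP p tp d i j : pbeyond p d i j ->
  pbeyond p d i (next (view (p, tp)) d i) /\
  (forall k, pbeyond p d i k -> ~~ pbeyond p d k (next (view (p, tp)) d i)).
Proof.
case/(@nearest_exists _ tp) => k Hk; rewrite /next.
by case: pickP => [l /nearestP|/(_ k)]; rewrite ?Hk.
Qed.

(** * The one-tape simulator and its correctness *)

Variables (Q : finType) (q0 : Q) (tr : Q -> view_t -> act * (Q + bool)) (e : I).

(** [TInit] blanks cell 0 and [TScan] runs to the end of the input, remembering the first symbol. In
    [TSim] the machine stands on the hole of [u], with the view in its state. [TBack] undoes a
    compulsory right move, [TWalk] goes from hole to hole towards the head to be moved, and [TLand]
    is the arrival of that head on its new cell. *)
Inductive tst :=
  | TInit
  | TScan of option bool
  | TSim of (Q + bool) & view_t & I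
  | TBack of (Q + bool) & view_t & I
  | TWalk of Q & view_t & I & bool
  | TLand of (Q + bool) & view_t & I & bool.

Definition tst_code (t : tst) :
    unit + option bool + (Q + bool) * view_t * I + (Q + bool) * view_t * I
    + Q * view_t * I * bool + (Q + bool) * view_t * I * bool :=
  match t with
  | TInit => inl (inl (inl (inl (inl tt))))
  | TScan b => inl (inl (inl (inl (inr b))))
  | TSim r v u => inl (inl (inl (inr (r, v, u))))
  | TBack r v u => inl (inl (inr (r, v, u)))
  | TWalk q v u d => inl (inr (q, v, u, d))
  | TLand q v u d => inr (q, v, u, d)
  end.

Definition tst_decode
    (c : unit + option bool + (Q + bool) * view_t * I + (Q + bool) * view_t * I
    + Q * view_t * I * bool + (Q + bool) * view_t * I * bool) : tst :=
  match c with
  | inl (inl (inl (inl (inl _)))) => TInit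
  | inl (inl (inl (inl (inr b)))) => TScan b
  | inl (inl (inl (inr (r, v, u)))) => TSim r v u
  | inl (inl (inr (r, v, u))) => TBack r v u
  | inl (inr (q, v, u, d)) => TWalk q v u d
  | inr (q, v, u, d) => TLand q v u d
  end.

Lemma tst_codeK : cancel tst_code tst_decode.
Proof. by case. Qed.

HB.instance Definition _ := Finite.copy tst (can_type tst_codeK).

(** One action of the automaton, begun on the hole of [u]. A write changes only the view, since the
    cell is blank on the tape. A moved head leaves its symbol behind unless another head stays on
    the cell. To stay in place the machine steps right and then back, because a left step at cell 0
    does not move. *)
Definition simact (r : Q + bool) (v : view_t) (u : I) : option (tst * option bool * bool) :=
  if r is inl q then
    let: (a, r') := tr q v in
    if enabled v a then
      match a with
      | Nop => None
      | Write i b => Some (TBack r' (wrview v i b) u, None, true)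
      | Move d i =>
          if ~~ v.1 (i, u) then Some (TWalk q v u true, None, true)
          else if ~~ v.1 (u, i) then Some (TWalk q v u false, None, false)
          else Some (TLand r' v i d,
                     if [exists j, (j != i) && v.1 (i, j) && v.1 (j, i)] then None else v.2 i, d)
      end
    else Some (TBack r' v u, None, true)
  else None.

Definition view0 (b : option bool) : view_t :=
  ([ffun jk : I * I => (jk.1 == e) ==> (jk.2 == e)],
   [ffun j => if j == e then None else b]).

Definition sim_delta (t : tst) (s : option bool) : option (tst * option bool * bool) :=
  match t with
  | TInit => Some (TScan s, None, true)
  | TScan b => if s is Some c then Some (TScan b, s, true) else simact (inl q0) (view0 b) e
  | TSim r v u => simact r v u
  | TBack r v u => Some (TSim r v u, s, false)
  | TWalk q v u d => if s is Some c then Some (TWalk q v u d, s, d)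
                     else simact (inl q) v (next v d u)
  | TLand r v i d => Some (TBack r (mvview v i d s) i, None, true)
  end.

Notation tconfs := (tconf tst).
Notation tsteps := (titer sim_delta).

(** Stated through the reaction to a blank, so that it covers [TSim], a [TWalk] that has met a hole,
    and the end of [TScan] alike. *)
Definition at_hole (c : tconfs) r p tp u :=
  [/\ c.1.2 = real p tp, c.2 = p u & sim_delta c.1.1 None = simact r (view (p, tp)) u].

Lemma at_hole_step c r p tp u st s d : at_hole c r p tp u ->
  simact r (view (p, tp)) u = Some (st, s, d) ->
  tstep sim_delta c = Some (st, upd (real p tp) (p u) s, shift d (p u)).
Proof.
case: c => [[q t] h] [/= -> -> E] S; rewrite /tstep real_head E S.
by case: d S.
Qed.

Lemma upd_id p tp u : upd (real p tp) (p u) None = real p tp.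
Proof.
by apply/funext => x; rewrite /upd; case: eqP => // ->; rewrite real_head.
Qed.

Lemma back_step r v u (t : nat -> option bool) x :
  tstep sim_delta (TBack r v u, t, x.+1) = Some (TSim r v u, t, x).
Proof.
rewrite /tstep /=; congr (Some (_, _, _)).
by apply/funext => y; case: eqP => // ->.
Qed.

Lemma stay_steps c q r p tp tp' u : at_hole c (inl q) p tp u ->
  real p tp' = real p tp ->
  simact (inl q) (view (p, tp)) u = Some (TBack r (view (p, tp')) u, None, true) ->
  exists c', tsteps 2 c = Some c' /\ at_hole c' r p tp' u.
Proof.
move=> H tpE S; rewrite /titer (at_hole_step H S) upd_id back_step.
by eexists; split; first reflexivity; split.
Qed.

Section Step.

Variables (q : Q) (r : Q + bool) (p : I -> nat) (tp : nat -> option bool).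
Variables (i : I) (d : bool).
Hypotheses (F : filled (p, tp)) (trE : tr q (view (p, tp)) = (Move d i, r)).
Hypothesis en : enabled (view (p, tp)) (Move d i).

Notation v := (view (p, tp)).

Lemma simact_right u : p u < p i -> simact (inl q) v u = Some (TWalk q v u true, None, true).
Proof. by move=> ui; rewrite /simact trE en view1 /= -ltnNge ui. Qed.

Lemma simact_left u : p i < p u -> simact (inl q) v u = Some (TWalk q v u false, None, false).
Proof. by move=> iu; rewrite /simact trE en !view1 /= -!ltnNge iu ltnNge ltnW. Qed.

Lemma walk_step u (w : bool) x b : real p tp x = Some b ->
  tstep sim_delta (TWalk q v u w, real p tp, x) = Some (TWalk q v u w, real p tp, shift w x).
Proof.
move=> rx; rewrite /tstep rx /=; case: w; congr (Some (_, _, _));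
  by apply/funext => y; case: eqP => // ->.
Qed.

Lemma no_head_real x j : x < p j -> ~~ [exists k, p k == x] ->
  exists b, real p tp x = Some b.
Proof.
move=> xj nh; have := F xj; rewrite /real (negPf nh) /=.
by case: (tp x) => // b _; exists b.
Qed.

(** Induction on the distance to the target. A cell without heads carries a symbol by [F] and is
    crossed; a cell with a head is the hole of the next head after [u], where the walk stops or
    continues from that head. *)
Lemma walk_right m u x : p i - x = m -> p u < x <= p i ->
  (forall j, p u < p j -> x <= p j) ->
  exists t c' w, [/\ t <= m,
    tsteps t (TWalk q v u true, real p tp, x) = Some c',
    at_hole c' (inl q) p tp w & p w = p i].
Proof.
elim: m u x => [|m IH] u x mE /andP[ux xi] Hx.
all: have [/existsP[j /eqP jx]|nh] := boolP [exists j, p j == x].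
1,3: have [Hn1 Hn2] : pbeyond p true u (next v true u) /\
       (forall k, pbeyond p true u k -> ~~ pbeyond p true k (next v true u))
     by apply: (@nextP p tp true u j); rewrite /= jx.
(* By [Hx] no head lies strictly between [u] and [x]. *)
1,2: have nx : p (next v true u) = x
     by (have := Hn2 j; have := Hx _ Hn1; rewrite /= jx; lia).
1,2: have H : at_hole (TWalk q v u true, real p tp, x) (inl q) p tp (next v true u) by split.
- by exists 0, (TWalk q v u true, real p tp, x), (next v true u); split=> //; lia.
- have wi : p (next v true u) < p i by lia.
  have st := at_hole_step H (simact_right wi).
  rewrite upd_id /= in st.
  have [] := IH (next v true u) x.+1; [lia|lia|by move=> k; lia|].
  move=> t [c' [w [tm cE Hw wi']]]; exists t.+1, c', w; split=> //.
  by rewrite -cE /titer -/titer; move: st => /= ->; rewrite nx.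
- by move/existsPn/(_ i): nh; case: eqP => //; lia.
- have xi' : x < p i by lia.
  have [b rb] := no_head_real xi' nh.
  have [|||t [c' [w [tm cE Hw wi']]]] := IH u x.+1.
  + lia.
  + lia.
  + move=> k uk; have := Hx k uk; move/existsPn/(_ k): nh; lia.
  by exists t.+1, c', w; split=> //; rewrite /titer -/titer (walk_step _ _ rb).
Qed.

Lemma walk_left m u x : x - p i = m -> p i <= x < p u ->
  (forall j, p j < p u -> p j <= x) ->
  exists t c' w, [/\ t <= m,
    tsteps t (TWalk q v u false, real p tp, x) = Some c',
    at_hole c' (inl q) p tp w & p w = p i].
Proof.
elim: m u x => [|m IH] u x mE /andP[xi ux] Hx.
all: have [/existsP[j /eqP jx]|nh] := boolP [exists j, p j == x].
1,3: have [Hn1 Hn2] : pbeyond p false u (next v false u) /\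
       (forall k, pbeyond p false u k -> ~~ pbeyond p false k (next v false u))
     by apply: (@nextP p tp false u j); rewrite /= jx.
1,2: have nx : p (next v false u) = x
     by (have := Hn2 j; have := Hx _ Hn1; rewrite /= jx; lia).
1,2: have H : at_hole (TWalk q v u false, real p tp, x) (inl q) p tp (next v false u) by split.
- by exists 0, (TWalk q v u false, real p tp, x), (next v false u); split=> //; lia.
- have wi : p i < p (next v false u) by lia.
  have st := at_hole_step H (simact_left wi).
  rewrite upd_id /= in st.
  have [] := IH (next v false u) x.-1; [lia|lia|by move=> k; lia|].
  move=> t [c' [w [tm cE Hw wi']]]; exists t.+1, c', w; split=> //.
  by rewrite -cE /titer -/titer; move: st => /= ->; rewrite nx.
- by move/existsPn/(_ i): nh; case: eqP => //; lia.
- have [b rb] := no_head_real ux nh.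
  have xi' : p i < x by move/existsPn/(_ i): nh; lia.
  have [|||t [c' [w [tm cE Hw wi']]]] := IH u x.-1.
  + lia.
  + lia.
  + move=> k uk; have := Hx k uk; move/existsPn/(_ k): nh; lia.
  by exists t.+1, c', w; split=> //; rewrite /titer -/titer (walk_step _ _ rb).
Qed.

Lemma walk_to c u N : (forall j, p j <= N) -> at_hole c (inl q) p tp u ->
  exists t c' w, [/\ t <= N, tsteps t c = Some c', at_hole c' (inl q) p tp w & p w = p i].
Proof.
move=> bN H; have [ui|iu|ui] := ltngtP (p u) (p i).
- have st := at_hole_step H (simact_right ui).
  have [||t [c' [w [tm cE Hw wi]]]] := walk_right (u := u) (x := (p u).+1) erefl.
  + lia.
  + by [].
  exists t.+1, c', w; split=> //; first by have := bN i; lia.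
  by rewrite /titer -/titer st upd_id.
- have st := at_hole_step H (simact_left iu).
  have [||t [c' [w [tm cE Hw wi]]]] := walk_left (u := u) (x := (p u).-1) erefl.
  + lia.
  + by move=> j; lia.
  exists t.+1, c', w; split=> //; first by have := bN u; lia.
  by rewrite /titer -/titer st upd_id.
- by exists 0, c, u; split.
Qed.

(** Three steps: leave the old cell, update the view from the arrival symbol while blanking the new
    cell, and step back onto it. *)
Lemma land_steps c u : at_hole c (inl q) p tp u -> p u = p i ->
  exists c', tsteps 3 c = Some c' /\
    at_hole c' r (upd p i (shift d (p i))) tp i.
Proof.
move=> H ui; set x := shift d (p i); set p' := upd p i x.
(* As the move is enabled, a left move does not start at cell 0, so the cell really changes. *)
have xN : x != p i.
  move: en => /= /existsP[j]; rewrite beyondE /x /=; case: (d) => /=; lia.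
set s := if [exists j, (j != i) && (p j == p i)] then None else tp (p i).
have S : simact (inl q) v u = Some (TLand r v i d, s, d).
  rewrite /simact trE en !view1 view2 /= ui leqnn /=; congr (Some (_, _, _)).
  rewrite /s; congr (if _ then _ else _); apply: eq_existsb => j.
  by rewrite !ffunE /= -andbA -eqn_leq (eq_sym (p i)).
have st := at_hole_step H S; rewrite ui -/x in st.
have rx : upd (real p tp) (p i) s x = real p tp x by rewrite /upd (negPf xN).
have st2 : tstep sim_delta (TLand r v i d, upd (real p tp) (p i) s, x) =
    Some (TBack r (view (p', tp)) i, real p' tp, x.+1).
  rewrite /tstep rx [sim_delta _ _]/= (mvviewP F en) -/x -/p'.
  congr (Some (_, _, _)); apply/funext => y; rewrite /real /p' /upd.
  have [->|yx] := eqVneq y x.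
    by case: existsP => // -[]; exists i; rewrite eqxx.
  have [->|yi] := eqVneq y (p i).
    rewrite /s; case: existsP => [[j /andP[ji /eqP jpi]]|nj].
      by case: existsP => // -[]; exists j; rewrite (negPf ji) jpi.
    case: existsP => // -[j]; have [_|ji] := eqVneq j i; first by rewrite (negPf xN).
    by move=> jpi; case: nj; exists j; rewrite ji.
  congr (if _ then _ else _); apply: eq_existsb => j.
  have [->|//] := eqVneq j i; by rewrite eq_sym (negPf yi) eq_sym (negPf yx).
exists (TSim r (view (p', tp)) i, real p' tp, x); split.
  by rewrite /titer st st2 back_step.
by split=> //=; rewrite /p' /upd eqxx.
Qed.

End Step.

(** At most [N] steps reach the head concerned, and three more carry out the action. *)
Lemma sim_step c q a r s u N : filled s -> (forall j, s.1 j <= N) ->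
    at_hole c (inl q) s.1 s.2 u -> tr q (view s) = (a, r) ->
  exists t c' u', [/\ t <= N + 3, tsteps t c = Some c' &
    at_hole c' r (mact a s).1 (mact a s).2 u'].
Proof.
case: s => p tp /= F bN H trE; rewrite /mact.
case en: (enabled _ a); last first.
  have [|c' [cE Hc]] := @stay_steps c q r p tp tp u H erefl.
    by rewrite /simact trE en.
  by exists 2, c', u; split=> //; lia.
case: a en trE => [//|d i|i b] en trE.
  have [t [c1 [w [tN c1E H1 wi]]]] := walk_to F trE en bN H.
  have [c2 [c2E H2]] := land_steps F trE en H1 wi.
  exists (t + 3), c2, i; split=> //; first by rewrite leq_add2r.
  by rewrite (titerD _ c1E).
have [||c' [cE Hc]] := @stay_steps c q r p tp (upd tp (p i) (Some b)) u H.
- apply/funext => x; rewrite /real /upd; case: ifP => // /existsPn/(_ i).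
  by rewrite eq_sym => /negPf->.
- by rewrite /simact trE en wrviewP.
by exists 2, c', u; split=> //; lia.
Qed.

Lemma mact_bound a s N : (forall j, s.1 j <= N) -> forall j, (mact a s).1 j <= N.
Proof.
move=> bN j; rewrite /mact; case: ifP => // en; case: a en => [//|d i|i b'] /=; last by [].
case/existsP => k; rewrite beyondE /= /upd; have := bN j; have := bN k; have := bN i.
by case: eqP; case: d => //=; lia.
Qed.

Inductive reach : Q -> data -> nat -> bool -> data -> Prop :=
  | ReachExit q s a b : tr q (view s) = (a, inr b) -> reach q s 1 b (mact a s)
  | ReachStep q s a q' t b s' : tr q (view s) = (a, inl q') ->
      reach q' (mact a s) t b s' -> reach q s t.+1 b s'.

Lemma sim_reach q s t b s' : reach q s t b s' ->
  forall N c u, filled s -> (forall j, s.1 j <= N) -> at_hole c (inl q) s.1 s.2 u ->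
  exists m c' u', [/\ m <= t * (N + 3), tsteps m c = Some c' &
    at_hole c' (inr b) s'.1 s'.2 u'].
Proof.
elim=> {q s t b s'} [q s a b trE|q s a q' t b s' trE _ IH] N c u F bN H.
  by rewrite mul1n; apply: (sim_step F bN H trE).
have [m1 [c1 [u1 [m1N c1E H1]]]] := sim_step F bN H trE.
have [m2 [c2 [u2 [m2N c2E H2]]]] := IH N c1 u1 (filled_mact F) (mact_bound a bN) H1.
exists (m1 + m2), c2, u2; split=> //; last by rewrite (titerD _ c1E).
by rewrite mulSn leq_add.
Qed.

Definition input_tape (w : seq bool) : nat -> option bool :=
  fun x => if x < size w then Some (nth false w x) else None.

Definition data0 (w : seq bool) : data :=
  (fun j => if j == e then size w else 0, input_tape w).

Lemma filled_data0 w : filled (data0 w).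
Proof.
by move=> j x /=; case: eqP => // _ xw; rewrite /input_tape xw.
Qed.

(** All heads except [e] start at cell 0. The head [z] makes that cell a hole, blanked by the first
    step, and the first blank met afterwards is the cell of [e]. *)
Lemma init_steps w z : z != e -> 0 < size w ->
  exists c, tsteps (size w) (TInit, input_tape w, 0) = Some c /\
    at_hole c (inl q0) (data0 w).1 (data0 w).2 e.
Proof.
move=> ze w0; set s0 := data0 w; set b := input_tape w 0.
have realE : upd (input_tape w) 0 None = real s0.1 s0.2.
  apply/funext => x; rewrite /upd /real.
  have [->|x0] := eqVneq x 0.
    by case: existsP => // -[]; exists z; rewrite /= (negPf ze).
  case: existsP => // -[j]; rewrite /s0 /=; case: (j == e) => /eqP xE.
    by rewrite /input_tape -xE ltnn.
  by rewrite -xE in x0.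
have scan m : m < size w ->
    tsteps m.+1 (TInit, input_tape w, 0) = Some (TScan b, real s0.1 s0.2, m.+1).
  elim: m => [|m IH] mw; first by rewrite /titer /tstep /= -/b -realE.
  rewrite -[in LHS]addn1 (titerD _ (IH (ltnW mw))) /titer /tstep.
  have rm : real s0.1 s0.2 m.+1 = Some (nth false w m.+1).
    by rewrite -realE /upd /= /input_tape mw.
  rewrite rm /=; congr (Some (_, _, _)).
  by apply/funext => y; case: eqP => // ->; rewrite rm.
exists (TScan b, real s0.1 s0.2, size w); split.
  by have := scan (size w).-1; rewrite prednK // => -> //; lia.
suff vE : view0 b = view s0.
  by split; [by [] | by rewrite /= eqxx | rewrite -[view _]vE].
apply: injective_projections; apply/ffunP.
  case=> j k; rewrite view1 ffunE /=; case: (j == e); case: (k == e) => //=; lia.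
move=> j; rewrite view2 ffunE /=; case: (j == e) => //.
by rewrite /input_tape ltnn.
Qed.

Theorem simulation w z t b s' : z != e -> 0 < size w ->
  reach q0 (data0 w) t b s' ->
  exists m cf, [/\ m <= size w + t * (size w + 3) + 1,
    run m (init (tm_of TInit sim_delta) w) = Some cf &
    forall x, cf.1.2 x = real s'.1 s'.2 x].
Proof.
move=> ze w0 R; have [c [cE H]] := init_steps ze w0.
have bN j : (data0 w).1 j <= size w by rewrite /=; case: ifP.
have [m [c' [u [mN c'E [tpE hE dE]]]]] := sim_reach R (filled_data0 (w := w)) bN H.
exists (size w + m).+1, (econf TInit sim_delta c'); split.
- by rewrite addn1 ltnS leq_add2l.
- rewrite init_tm_of; apply: run_tm_of; first by rewrite (titerD _ cE).
  case: c' tpE hE dE {c'E} => [[st t'] h] /= -> -> E.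
  by rewrite real_head E.
- by move=> x; rewrite /econf /= tpE.
Qed.

End Multihead.

(** * Structured programs for multihead automata *)

Section Programs.

Variable I : finType.

Implicit Types (i j : I) (d : bool) (p : I -> nat).

Notation data := (data I).
Notation view_t := (view_t I).
Notation act := (act I).

(** Every program exits with a bit: [Ite] branches on the exit of its first part, and [Loop] repeats
    its body until that exits with [false]. Passing from one part to the next costs no step. *)
Inductive prog :=
  | Prim of (view_t -> act * bool)
  | Ite of prog & prog & prog
  | Loop of prog.

Fixpoint pst (P : prog) : finType :=
  match P with
  | Prim _ => unit
  | Ite P1 P2 P3 => (pst P1 + pst P2 + pst P3)%type
  | Loop P1 => pst P1
  end.

Fixpoint pstart (P : prog) : pst P :=
  match P with
  | Prim _ => tt
  | Ite P1 _ _ => inl (inl (pstart P1))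
  | Loop P1 => pstart P1
  end.

Definition lift_exit (S S' : Type) (inj : S -> S') (exit : bool -> S' + bool)
    (r : act * (S + bool)) : act * (S' + bool) :=
  (r.1, match r.2 with inl q => inl (inj q) | inr b => exit b end).

Fixpoint ptr (P : prog) : pst P -> view_t -> act * (pst P + bool) :=
  match P with
  | Prim f => fun _ v => ((f v).1, inr (f v).2)
  | Ite P1 P2 P3 => fun q v =>
      match q with
      | inl (inl q1) =>
          lift_exit (fun q => inl (inl q))
            (fun b => inl (if b then inl (inr (pstart P2)) else inr (pstart P3)))
            (@ptr P1 q1 v)
      | inl (inr q2) => lift_exit (fun q => inl (inr q)) inr (@ptr P2 q2 v)
      | inr q3 => lift_exit inr inr (@ptr P3 q3 v)
      end
  | Loop P1 => fun q v =>
      lift_exit id (fun b => if b then inl (pstart P1) else inr false) (@ptr P1 q v)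
  end.

Inductive big : prog -> data -> nat -> bool -> data -> Prop :=
  | BPrim f s a b : f (view s) = (a, b) -> big (Prim f) s 1 b (mact a s)
  | BIte P1 P2 P3 s t1 b1 s1 t2 b2 s2 : big P1 s t1 b1 s1 ->
      big (if b1 then P2 else P3) s1 t2 b2 s2 -> big (Ite P1 P2 P3) s (t1 + t2) b2 s2
  | BLoopT P s t1 s1 t2 b2 s2 : big P s t1 true s1 ->
      big (Loop P) s1 t2 b2 s2 -> big (Loop P) s (t1 + t2) b2 s2
  | BLoopF P s t s1 : big P s t false s1 -> big (Loop P) s t false s1.

(** Serves all embeddings of a program into a larger one: an exit either ends the larger run too, or
    hands over to a state whose run is appended. *)
Lemma reach_lift (Q1 Q2 : finType) (tr1 : Q1 -> view_t -> act * (Q1 + bool))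
    (tr2 : Q2 -> view_t -> act * (Q2 + bool)) (inj : Q1 -> Q2) (exit : bool -> Q2 + bool) :
    (forall q v, tr2 (inj q) v = lift_exit inj exit (tr1 q v)) ->
  forall q s t b s1, reach tr1 q s t b s1 ->
  match exit b with
  | inr b' => reach tr2 (inj q) s t b' s1
  | inl q' => forall t2 b2 s2, reach tr2 q' s1 t2 b2 s2 ->
      reach tr2 (inj q) s (t + t2) b2 s2
  end.
Proof.
move=> trE q s t b s1; elim=> {q s t b s1} [q s a b E|q s a q' t b s' E _ IH].
  have := trE q (view s); rewrite E /lift_exit /=.
  by case: (exit b) => [q'|b'] E2 => [t2 b2 s2 R|]; [exact: (ReachStep E2 R)|exact: ReachExit].
have := trE q (view s); rewrite E /lift_exit /= => E2.
by case: (exit b) IH => [q''|b'] IH => [t2 b2 s2 /IH R|];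
  [exact: (ReachStep E2 R)|exact: (ReachStep E2 IH)].
Qed.

Lemma big_reach P s t b s' : big P s t b s' -> reach (@ptr P) (pstart P) s t b s'.
Proof.
elim=> {P s t b s'} [f s a b E|P1 P2 P3 s t1 b1 s1 t2 b2 s2 _ IH1 _ IH2
   |P s t1 s1 t2 b2 s2 _ IH1 _ IH2|P s t s1 _ IH].
- by apply: ReachExit; rewrite /= E.
- have := @reach_lift _ _ (@ptr P1) (@ptr (Ite P1 P2 P3)) (fun q => inl (inl q))
    (fun b => inl (if b then inl (inr (pstart P2)) else inr (pstart P3)))
    (fun _ _ => erefl) _ _ _ _ _ IH1.
  rewrite /=; apply; case: b1 IH1 IH2 => _ IH2.
    exact: (@reach_lift _ _ (@ptr P2) (@ptr (Ite P1 P2 P3))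
      (fun q => inl (inr q)) inr (fun _ _ => erefl) _ _ _ _ _ IH2).
  exact: (@reach_lift _ _ (@ptr P3) (@ptr (Ite P1 P2 P3))
      inr inr (fun _ _ => erefl) _ _ _ _ _ IH2).
- have := @reach_lift _ _ (@ptr P) (@ptr (Loop P)) id
    (fun b => if b then inl (pstart P) else inr false)
    (fun _ _ => erefl) _ _ _ _ _ IH1.
  by rewrite /=; apply.
exact: (@reach_lift _ _ (@ptr P) (@ptr (Loop P)) id
    (fun b => if b then inl (pstart P) else inr false)
    (fun _ _ => erefl) _ _ _ _ _ IH).
Qed.

Definition writes (a : act) := if a is Write _ _ then true else false.

Fixpoint readonly (P : prog) : Prop :=
  match P with
  | Prim f => forall v, ~~ writes (f v).1
  | Ite P1 P2 P3 => [/\ readonly P1, readonly P2 & readonly P3]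
  | Loop P1 => readonly P1
  end.

Lemma readonly_ptr P : readonly P -> forall q v, ~~ writes (@ptr P q v).1.
Proof.
elim: P => [f|P1 IH1 P2 IH2 P3 IH3|P1 IH1] /=; first by [].
  by case=> /IH1 H1 /IH2 H2 /IH3 H3 [[q|q]|q] v /=.
by move=> /IH1 H1 q v /=.
Qed.

Lemma mact_readonly a (s : data) : ~~ writes a -> (mact a s).2 = s.2.
Proof. by rewrite /mact; case: ifP => // _; case: a. Qed.

Lemma big_bound P s t b s' N : big P s t b s' -> (forall i, s.1 i <= N) ->
  forall i, s'.1 i <= N.
Proof.
elim=> {P s t b s'} [f s a b _|P1 P2 P3 s t1 b1 s1 t2 b2 s2 _ IH1 _ IH2
   |P s t1 s1 t2 b2 s2 _ IH1 _ IH2|P s t s1 _ IH] bN; last exact: IH.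
- exact: mact_bound.
- by apply: IH2; apply: IH1.
- by apply: IH2; apply: IH1.
Qed.

(** * Time bound for runs that do not write *)

Section Pigeonhole.

Variables (Q : finType) (tr : Q -> view_t -> act * (Q + bool)).

Lemma reach_inv q s t b s' : reach tr q s t b s' ->
  if tr q (view s) is (a, inl q')
  then exists2 t', t = t'.+1 & reach tr q' (mact a s) t' b s' else t = 1.
Proof.
case=> {q s t b s'} [q s a b E|q s a q' t b s' E R]; rewrite E //.
by exists t.
Qed.

Lemma reach_det q s t b s' : reach tr q s t b s' ->
  forall t2 b2 s2, reach tr q s t2 b2 s2 -> t2 = t.
Proof.
elim=> {q s t b s'} [q s a b E|q s a q' t b s' E _ IH] t2 b2 s2 /reach_inv;
  rewrite E // => -[t' -> /IH ->] //.
Qed.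

Hypothesis ro : forall q v, ~~ writes (tr q v).1.

Variable N : nat.

Definition pos_code (s : data) : {ffun I -> 'I_N.+1} := [ffun i => inord (s.1 i)].

Lemma pos_code_inj (s s' : data) : (forall i, s.1 i <= N) -> (forall i, s'.1 i <= N) ->
  s.2 = s'.2 -> pos_code s = pos_code s' -> s = s'.
Proof.
case: s s' => [p tp] [p' tp'] /= bp bp' -> /ffunP E; congr (_, _).
by apply/funext => i; have := congr1 val (E i); rewrite !ffunE /= !inordK ?ltnS.
Qed.

(* Without writing, a configuration is determined by the control state and the
   head positions, and no configuration repeats in a halting run. *)
Lemma reach_time q s t b s' : reach tr q s t b s' -> (forall i, s.1 i <= N) ->
  t <= #|Q| * N.+1 ^ #|I|.
Proof.
move=> R bN; pose good (t0 : nat) (tp : nat -> option bool)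
   (c : Q * {ffun I -> 'I_N.+1}) :=
  exists s1 t1 b1 s2, [/\ t1 <= t0, c.2 = pos_code s1, (forall i, s1.1 i <= N),
    s1.2 = tp & reach tr c.1 s1 t1 b1 s2].
suff [l [ul sl _]] : exists l, [/\ uniq l, size l = t & forall c, c \in l -> good t s.2 c].
  have := max_card (mem l); rewrite card_prod card_ffun card_ord.
  by rewrite (card_uniqP ul) sl.
elim: R bN => {q s t b s'} [q s a b E|q s a q' t b s' E R IH] bN.
  exists [:: (q, pos_code s)]; split=> // c; rewrite inE => /eqP->.
  by exists s, 1, b, (mact a s); split=> //; apply: ReachExit.
have naw : ~~ writes a by have := ro q (view s); rewrite E.
have [|l [ul sl Hl]] := IH; first exact: mact_bound.
rewrite mact_readonly // in Hl.
exists ((q, pos_code s) :: l); split=> /=; last 2 first.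
- by rewrite sl.
- move=> c; rewrite inE => /orP[/eqP->|/Hl [s1 [t1 [b1 [s2 [t1t ? ? ? ?]]]]]].
    by exists s, t.+1, b, s'; split=> //; apply: ReachStep E R.
  by exists s1, t1, b1, s2; split=> //; apply: leqW.
(* If the current configuration recurred, it would start a halting run of length at most [t], but by
   determinism its run has length [t.+1]. *)
rewrite ul andbT; apply/negP => /Hl [s1 [t1 [b1 [s2 [t1t /= sE bN1 tpE R1]]]]].
have ss1 : s = s1 by apply: pos_code_inj.
rewrite -ss1 in R1; have := reach_det R1 (ReachStep E R).
by move=> tE; rewrite -tE ltnn in t1t.
Qed.

End Pigeonhole.

Lemma big_time P s t b s' N : readonly P -> big P s t b s' -> (forall i, s.1 i <= N) ->
  t <= #|pst P| * N.+1 ^ #|I|.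
Proof.
by move=> /readonly_ptr ro /big_reach R bN; apply: (reach_time ro R bN).
Qed.

Definition ret b := Prim (fun _ => (Nop I, b)).
Definition test (c : view_t -> bool) := Prim (fun v => (Nop I, c v)).
Definition mv d i := Prim (fun _ => (Move d i, true)).
Definition pseq P1 P2 := Ite P1 P2 P2.
Definition tlt i j := test (fun v => beyond v true i j).
Definition moveto d i j :=
  Loop (Prim (fun v => if beyond v d i j then (Move d i, true) else (Nop I, false))).
Definition copy i j := pseq (moveto true i j) (moveto false i j).

Lemma moveto_readonly d i j : readonly (moveto d i j).
Proof. by move=> v /=; case: ifP. Qed.

(** * Total correctness rules for programs that leave the tape unchanged *)

Section WP.

Variable tp : nat -> option bool.

(** Termination is included but no time is recorded: for programs without writes [big_time] supplies
    the bound. *)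
Definition wp P (Q : bool -> (I -> nat) -> Prop) p :=
  exists t b p', big P (p, tp) t b (p', tp) /\ Q b p'.

Lemma wp_mono P (Q Q' : bool -> (I -> nat) -> Prop) p :
  wp P Q p -> (forall b p', Q b p' -> Q' b p') -> wp P Q' p.
Proof. by case=> t [b [p' [B H]]] QQ'; exists t, b, p'; split=> //; apply: QQ'. Qed.

Lemma wp_ite P1 P2 P3 Q p :
  wp P1 (fun b p1 => wp (if b then P2 else P3) Q p1) p -> wp (Ite P1 P2 P3) Q p.
Proof.
case=> t1 [b1 [p1 [B1 [t2 [b2 [p2 [B2 H]]]]]]].
by exists (t1 + t2), b2, p2; split=> //; apply: BIte B1 B2.
Qed.

Lemma wp_seq P1 P2 Q p : wp P1 (fun _ p1 => wp P2 Q p1) p -> wp (pseq P1 P2) Q p.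
Proof. by move=> H; apply: wp_ite; apply: wp_mono H _ => -[] p'. Qed.

Lemma wp_test c (Q : bool -> (I -> nat) -> Prop) p :
  Q (c (view (p, tp))) p -> wp (test c) Q p.
Proof.
move=> H; exists 1, (c (view (p, tp))), p; split=> //.
exact: (@BPrim (fun v => (Nop I, c v)) (p, tp) (Nop I)).
Qed.

Lemma wp_ret b (Q : bool -> (I -> nat) -> Prop) p : Q b p -> wp (ret b) Q p.
Proof. exact: (@wp_test (fun _ => b)). Qed.

Lemma wp_tlt i j (Q : bool -> (I -> nat) -> Prop) p :
  Q (p i < p j) p -> wp (tlt i j) Q p.
Proof. by move=> H; apply: wp_test; rewrite beyondE. Qed.

Lemma mact_move d i j p : pbeyond p d i j ->
  mact (Move d i) (p, tp) = (upd p i (shift d (p i)), tp).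
Proof.
move=> ij; rewrite /mact; case: ifP => //= /existsP[]; exists j.
by rewrite beyondE.
Qed.

Lemma wp_mv d i j (Q : bool -> (I -> nat) -> Prop) p : pbeyond p d i j ->
  Q true (upd p i (shift d (p i))) -> wp (mv d i) Q p.
Proof.
move=> ij H; exists 1, true, (upd p i (shift d (p i))); split=> //.
by rewrite -(mact_move ij); apply: BPrim.
Qed.

(** At position [N] no head lies further right and the move is void; this makes address arithmetic
    saturate at [N]. *)
Lemma wp_mvE e N i (Q : bool -> (I -> nat) -> Prop) p : (forall j, p j <= N) -> p e = N ->
  Q true (upd p i (minn N (p i).+1)) -> wp (mv true i) Q p.
Proof.
move=> bN eN H; have [iN|iN] := ltnP (p i) N.
  by apply: (@wp_mv true i e); rewrite /= ?eN //; rewrite -(minn_idPr iN).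
exists 1, true, p; split; last first.
  have <- : upd p i (minn N (p i).+1) = p; last by [].
  apply/funext => j; rewrite /upd; case: eqP => // ->.
  have := bN i; lia.
have {2}-> : (p, tp) = mact (Move true i) (p, tp); last exact: BPrim.
rewrite /mact; case: ifP => // /existsP[j]; rewrite beyondE /= => ij.
by have := bN j; lia.
Qed.

Lemma wp_loop P (Inv : nat -> (I -> nat) -> Prop) (Q : bool -> (I -> nat) -> Prop) :
  (forall m p, Inv m p ->
     wp P (fun b p' => if b then exists2 m', m' < m & Inv m' p' else Q false p') p) ->
  forall m p, Inv m p -> wp (Loop P) Q p.
Proof.
move=> H m; have [M mM] := ubnP m; elim: M m mM => // M IH m mM p /H.
case=> t1 [[] [p1 [B1 H1]]]; last by exists t1, false, p1; split=> //; apply: BLoopF.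
case: H1 => m' m'm /IH []; first exact: leq_trans m'm _.
by move=> t2 [b2 [p2 [B2 H2]]]; exists (t1 + t2), b2, p2; split=> //; apply: BLoopT B1 B2.
Qed.

Lemma wp_bound P Q p N : wp P Q p -> (forall i, p i <= N) ->
  wp P (fun b p' => Q b p' /\ forall i, p' i <= N) p.
Proof.
case=> t [b [p' [B H]]] bN; exists t, b, p'; split=> //; split=> //.
exact: (big_bound B).
Qed.

Lemma upd_same (p : I -> nat) i x : upd p i x i = x.
Proof. by rewrite /upd eqxx. Qed.

Lemma upd_neq (p : I -> nat) i x j : j != i -> upd p i x j = p j.
Proof. by rewrite /upd => /negPf->. Qed.

Lemma upd_upd (p : I -> nat) i x y : upd (upd p i x) i y = upd p i y.
Proof. by apply/funext => j; rewrite /upd; case: eqP. Qed.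

Lemma upd_eta (p : I -> nat) i : upd p i (p i) = p.
Proof. by apply/funext => j; rewrite /upd; case: eqP => // ->. Qed.

Lemma wp_moveto d i j (Q : bool -> (I -> nat) -> Prop) p :
    Q false (if pbeyond p d i j then upd p i (p j) else p) -> wp (moveto d i j) Q p.
Proof.
move=> H; pose m (p1 : I -> nat) := if d then p j - p1 i else p1 i - p j.
pose Inv k p1 := m p1 = k /\ if pbeyond p d i j then
   [/\ p1 = upd p i (p1 i), p1 j = p j & (if d then p1 i <= p j else p j <= p1 i)]
   else p1 = p.
apply: (@wp_loop _ Inv _ _ (m p)); last first.
  split=> //; case: ifP => // ij; rewrite upd_eta; split=> //.
  by case: d ij {H m Inv}; apply: ltnW.
move=> k p1 [mk I1]; set f := fun v : view_t => _.
have [p1ij|p1ij] := boolP (pbeyond p1 d i j).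
  have fE : f (view (p1, tp)) = (Move d i, true) by rewrite /f beyondE p1ij.
  exists 1, true, (upd p1 i (shift d (p1 i))); split.
    by rewrite -(mact_move p1ij); apply: BPrim.
  have ij : i != j by apply: contraL p1ij => /eqP->; case: (d) => /=; rewrite ltnn.
  move: I1; case: ifP => [pij [E Ej Ek]|pij E]; last by rewrite E pij in p1ij.
  exists (m (upd p1 i (shift d (p1 i)))).
    by rewrite -mk /m !upd_same; move: p1ij {f fE H Inv Ek pij mk}; case: (d) => /=; lia.
  split=> //; rewrite pij !upd_same upd_neq 1?eq_sym //; split=> //.
    by rewrite E upd_upd upd_same.
  by rewrite -Ej; move: p1ij {f fE H Inv m mk Ek pij}; case: (d) => /=; lia.
exists 1, false, p1; split.
  have fE : f (view (p1, tp)) = (Nop I, false) by rewrite /f beyondE (negPf p1ij).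
  have {2}-> : (p1, tp) = mact (Nop I) (p1, tp) by [].
  exact: BPrim.
move: H I1; case: ifP => [_ H [E Ej Ek]|_ H -> //].
suff pE : p1 i = p j by rewrite E pE.
rewrite -Ej in Ek *; move: p1ij Ek {f H Inv m mk}; case: (d) => /=; lia.
Qed.

Lemma wp_copy i j (Q : bool -> (I -> nat) -> Prop) p :
  Q false (upd p i (p j)) -> wp (copy i j) Q p.
Proof.
move=> H; apply: wp_seq; apply: wp_moveto; apply: wp_moveto => /=.
have [ij|ij] := eqVneq i j; first by move: H; rewrite ij upd_eta !ltnn.
have [lt|lt|eq] := ltngtP (p i) (p j).
- by rewrite upd_same upd_neq 1?eq_sym // ltnn.
- by rewrite lt.
- by move: H; rewrite -eq upd_eta ?ltnn.
Qed.

End WP.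

End Programs.

(** * The search program *)

Section Algorithm.

Variable d : nat.

(** Besides eleven fixed heads there are [d] heads on the vertices of [Q] and [d] on those of [W];
    in the end [d] is [3 * r]. *)
Definition head := ('I_11 + ('I_d + 'I_d))%type.

Notation fx j := (inl (@Ordinal 11 j isT) : head).
(* Permanent heads: origin, end of the input, start of the adjacency matrix,
   and the number of vertices; the others are variables. *)
Notation hz := (fx 0).
Notation he := (fx 1).
Notation hb := (fx 2).
Notation hn := (fx 3).
Notation ht := (fx 4).
Notation hu := (fx 5).
Notation hw := (fx 6).
Notation hx := (fx 7).
Notation hy := (fx 8).
Notation hc := (fx 9).
Notation hm := (fx 10).

Definition qheads : seq head := [seq inr (inl i) | i <- enum 'I_d].
Definition wheads : seq head := [seq inr (inr i) | i <- enum 'I_d].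

Notation pos := (head -> nat).
Implicit Types (p : pos) (h : head) (l M : seq head) (P : prog head).

Definition agree M p p' := forall h, h \notin M -> p' h = p h.
(** Tests move scratch heads, so a condition evaluated after another test must not depend on the
    heads moved by it. *)
Definition indep M (f : pos -> bool) := forall p p', agree M p p' -> f p' = f p.
Definition permanent := [:: hz; he; hb; hn].
Definition temps := [:: ht; hu; hw].

Local Hint Extern 0 (is_true (_ \notin _)) => exact isT : core.
Local Hint Extern 0 (is_true (_ \in _)) => exact isT : core.

Lemma agree_trans M p1 p2 p3 : agree M p1 p2 -> agree M p2 p3 -> agree M p1 p3.
Proof. by move=> A B h hM; rewrite B // A. Qed.

Lemma agree_sub M M' p p' : {subset M <= M'} -> agree M p p' -> agree M' p p'.
Proof. by move=> S A h hM; apply: A; apply: contra hM; apply: S. Qed.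

Lemma agree_upd M p h v : h \in M -> agree M p (upd p h v).
Proof. by move=> hM h' h'M; rewrite upd_neq //; apply: contraNneq h'M => ->. Qed.

(** Head positions serve as counters: with loops of this form, addition is repeated increment and
    [addr] multiplies by repeated addition. *)
Definition for_ h h' P := pseq (copy h hz) (Loop (Ite (tlt h h') (pseq P (mv true h)) (ret _ false))).
Definition add h := for_ hu h (mv true ht).
Definition addr h h' := pseq (copy ht hb) (pseq (for_ hw h (add hn)) (add h')).
Definition bit := test (fun v : view_t head => v.2 ht == Some true).
Definition adjT h h' :=
  Ite (tlt h' h) (pseq (addr h h') bit) (Ite (tlt h h') (pseq (addr h' h) bit) (ret _ false)).
Definition memT l h := test (fun v : view_t head => has (fun h' => v.1 (h, h') && v.1 (h', h)) l).
Definition allT h l := foldr (fun h' P => Ite (adjT h h') P (ret _ false)) (ret _ true) l.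
Definition inT h :=
  Ite (memT qheads h) (ret _ true) (Ite (memT wheads h) (ret _ false) (allT h qheads)).
(** Success of [P] stops the loop with [h] still on the vertex that worked, so the final comparison
    with [hn] reports success and the heads keep the witness. *)
Definition exT h P :=
  pseq (copy h hz)
    (pseq (Loop (Ite (tlt h hn) (Ite P (ret _ false) (mv true h)) (ret _ false))) (tlt h hn)).
Definition badT :=
  exT hx (exT hy (Ite (memT [:: hx] hy) (ret _ false)
    (Ite (inT hx) (Ite (inT hy) (Ite (adjT hx hy) (ret _ false) (ret _ true)) (ret _ false))
       (ret _ false)))).
Definition countT :=
  pseq (copy hc hz) (pseq (for_ hx hn (Ite (inT hx) (ret _ true) (mv true hc))) (memT [:: hm] hc)).
Definition goodT := Ite badT (ret _ false) countT.
(* The head [hm], trying the number of vertices left out, is the outermost one: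
   the first candidate found is a largest one. *)
Definition search := exT hm (foldr exT goodT (qheads ++ wheads)).
Definition scan :=
  pseq (Loop (Ite (test (fun v : view_t head => v.2 hb == Some true)) (mv true hb) (ret _ false)))
      (mv true hb).
(** The input has length [k + 1 + n ^ 2], so [hn] is advanced until [k + 1] plus its square reaches
    the end. *)
Definition find_n :=
  Loop (Ite (pseq (addr hn hz) (tlt ht he)) (mv true hn) (ret _ false)).
Definition prepare := pseq scan (pseq find_n search).
Definition write h b := Prim (fun _ : view_t head => (Write h b, true)).
Definition output :=
  pseq (copy hx hz)
    (Loop (Ite (tlt hx hn) (pseq (Ite (inT hx) (write hx true) (write hx false)) (mv true hx))
       (ret _ false))).
(** Heads blank the cells on which they stand. All heads except [hn] are therefore sent to the end
    of the input; the hole of [hn] at cell [n] is the blank that must follow the output. *)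
Definition park l := foldr (fun h P => pseq (moveto true h he) P) (ret _ true) l.
Definition others := [seq h <- enum {: head} | h != hn].
Definition algorithm := pseq prepare (pseq output (park others)).

(** * Programs that do not write *)

Lemma readonly_ite P1 P2 P3 : readonly P1 -> readonly P2 -> readonly P3 ->
  readonly (Ite P1 P2 P3).
Proof. by split. Qed.

Lemma readonly_loop P : readonly P -> readonly (Loop P). Proof. by []. Qed.

Lemma readonly_seq P1 P2 : readonly P1 -> readonly P2 -> readonly (pseq P1 P2).
Proof. by split. Qed.

Lemma readonly_test c : readonly (@test head c). Proof. by []. Qed.

Lemma readonly_ret b : readonly (ret head b). Proof. by []. Qed.

Lemma readonly_tlt h h' : readonly (tlt h h'). Proof. by []. Qed.

Lemma readonly_mv b h : readonly (mv b h). Proof. by []. Qed.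

Lemma readonly_copy h h' : readonly (copy h h').
Proof. by split; apply: moveto_readonly. Qed.

Local Hint Resolve readonly_ite readonly_loop readonly_seq readonly_test readonly_ret
  readonly_tlt readonly_mv
  readonly_copy : ro.

Lemma readonly_adjT h h' : readonly (adjT h h').
Proof. by rewrite /adjT /addr /add /for_ /bit; auto 20 with ro. Qed.

Lemma readonly_inT h : readonly (inT h).
Proof.
apply: readonly_ite => //; apply: readonly_ite => //.
by rewrite /allT; elim: qheads => //= h' l IH; split=> //; apply: readonly_adjT.
Qed.

Lemma readonly_exT h P : readonly P -> readonly (exT h P).
Proof. by move=> roP; rewrite /exT; auto 20 with ro. Qed.

Local Hint Resolve readonly_adjT readonly_inT readonly_exT : ro.

Lemma readonly_prepare : readonly prepare.
Proof.
have ro_good : readonly goodT.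
  by rewrite /goodT /badT /countT /for_ /memT; auto 20 with ro.
have ro_s : readonly (foldr exT goodT (qheads ++ wheads)).
  by elim: (_ ++ _) => //= h l IH; apply: readonly_exT.
by rewrite /prepare /scan /find_n /search /addr /add /for_; auto 20 with ro.
Qed.

Lemma readonly_park l : readonly (park l).
Proof. by elim: l => //= h l IH; split=> //; apply: moveto_readonly. Qed.

(** * What the program computes, in terms of head positions *)

Section Semantics.

Variables (k n : nat) (tp : nat -> option bool).
Let N := k.+1 + n * n.

Notation bounded p := (forall h, p h <= N).
Definition frame (m : nat) p := [/\ p hz = 0, p he = N, p hb = k.+1 & p hn = m].

Lemma permanent_sub M M' : {subset M <= M'} ->
  ~~ has (mem M') permanent -> ~~ has (mem M) permanent.
Proof. by move=> S; apply: contra; apply: sub_has => h; apply: S. Qed.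

Lemma frame_agree m M p p' : ~~ has (mem M) permanent -> agree M p p' ->
  frame m p -> frame m p'.
Proof.
move=> /hasPn nM A [? ? ? ?]; split; rewrite A //; apply: nM; by rewrite !inE ?eqxx ?orbT.
Qed.

Lemma wp_for h h' P (Inv : nat -> pos -> Prop) p : h != h' -> p hz = 0 -> bounded p ->
    Inv 0 (upd p h 0) ->
    (forall j p1, j < p h' -> p1 h = j -> p1 h' = p h' -> bounded p1 -> Inv j p1 ->
       wp tp P (fun _ p2 => [/\ p2 h = j, p2 h' = p h' & Inv j.+1 (upd p2 h j.+1)]) p1) ->
  wp tp (for_ h h' P) (fun _ p2 => [/\ p2 h = p h', p2 h' = p h' & Inv (p h') p2]) p.
Proof.
move=> hh' z0 bN I0 Istep; apply: wp_seq; apply: wp_copy.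
pose J m p1 := [/\ m = p h' - p1 h, p1 h <= p h', p1 h' = p h', bounded p1 & Inv (p1 h) p1].
apply: (@wp_loop _ _ _ J _ _ (p h')); last first.
  rewrite /J upd_same z0 subn0 upd_neq 1?eq_sym //; split=> // i.
  by rewrite /upd; case: eqP.
move=> m p1 [mE le1 h'E b1 I1]; apply: wp_ite; apply: wp_tlt; rewrite h'E.
have [lt|ge] := ltnP (p1 h) (p h'); last first.
  apply: wp_ret; have hE : p1 h = p h' by apply/eqP; rewrite eqn_leq le1.
  by split=> //; rewrite -hE.
apply: wp_seq; have := wp_bound (Istep _ _ lt erefl h'E b1 I1) b1.
move=> /wp_mono; apply=> _ p2 [[hE h'E2 I2] b2].
apply: (@wp_mv _ _ _ _ h'); first by rewrite /= hE h'E2.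
exists (p h' - (p1 h).+1); first by rewrite mE; lia.
rewrite /J /= upd_same hE upd_neq 1?eq_sym //; split=> // i.
by rewrite /upd; case: eqP => // _; have := bN h'; lia.
Qed.

Lemma wp_add h p : h \notin temps -> p hz = 0 -> p he = N -> bounded p ->
  wp tp (add h) (fun _ p2 => agree [:: ht; hu] p p2 /\ p2 ht = minn N (p ht + p h)) p.
Proof.
move=> hT z0 eN bN.
have [hu_h ht_h] : hu != h /\ h != ht.
  by move: hT; rewrite !inE !negb_or => /and3P[-> hu' _]; rewrite eq_sym.
pose Inv j p1 := agree [:: ht; hu] p p1 /\ p1 ht = minn N (p ht + j).
have H : wp tp (add h) (fun _ p2 => [/\ p2 hu = p h, p2 h = p h & Inv (p h) p2]) p.
  apply: wp_for => //.
    split; first by apply: agree_upd; rewrite !inE eqxx orbT.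
    by rewrite upd_neq // addn0; apply/esym/minn_idPr.
  move=> j p1 jh uj hE b1 [A1 T1].
  apply: (@wp_mvE _ _ he N) => //; first by rewrite A1.
  rewrite upd_neq // upd_neq //; split=> //; split.
    apply: agree_trans A1 _; apply: (agree_trans (p2 := upd p1 ht (minn N (p1 ht).+1)));
    by apply: agree_upd; rewrite !inE eqxx ?orbT.
  by rewrite upd_neq // upd_same T1; lia.
by apply: wp_mono H _ => _ p2 [].
Qed.

Lemma wp_addr h h' p : h \notin temps -> h' \notin temps -> p hz = 0 -> p he = N -> bounded p ->
  wp tp (addr h h')
    (fun _ p2 => agree temps p p2 /\ p2 ht = minn N (p hb + p h * p hn + p h')) p.
Proof.
move=> hT h'T z0 eN bN; apply: wp_seq; apply: wp_copy; apply: wp_seq.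
set p0 := upd p ht (p hb).
have A0 : agree temps p p0 by apply: agree_upd.
have b0 : bounded p0 by move=> i; rewrite /p0 /upd; case: eqP.
have hE0 : p0 h = p h by rewrite A0.
pose Inv j p1 := agree temps p p1 /\ p1 ht = minn N (p hb + j * p hn).
have H : wp tp (for_ hw h (add hn))
    (fun _ p2 => [/\ p2 hw = p0 h, p2 h = p0 h & Inv (p0 h) p2]) p0.
  apply: wp_for => //.
  - by apply: contraNneq hT => <-.
  - split; first by apply: agree_trans A0 _; apply: agree_upd.
    by rewrite upd_neq // /p0 upd_same addn0; apply/esym/minn_idPr.
  move=> j p1 jh wj hE b1 [A1 T1].
  have := @wp_add hn p1 isT; rewrite (A1 hz) // (A1 he) // (A1 hn) //.
  move=> /(_ z0 eN b1) /wp_mono; apply.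
  move=> _ p2 [A2 T2]; rewrite !A2 //; last first.
    by move: hT; rewrite !inE !negb_or => /and3P[-> -> _].
  split=> //; split.
    apply: agree_trans A1 _; apply: (agree_trans (p2 := p2)); last exact: agree_upd.
    by apply: agree_sub A2; move=> i; rewrite !inE orbA => ->.
  by rewrite upd_neq // T2 T1 mulSn; lia.
apply: wp_mono (wp_bound H b0) _ => _ p1 [[_ _ [A1 T1]] b1].
have := @wp_add h' p1 h'T; rewrite (A1 hz) // (A1 he) // (A1 h') //.
move=> /(_ z0 eN b1) /wp_mono; apply.
move=> _ p2 [A2 T2]; split; last by rewrite T2 T1 hE0; lia.
by apply: agree_trans A1 _; apply: agree_sub A2; move=> i; rewrite !inE orbA => ->.
Qed.

(* Heads stop at the end of the input, hence the [minn]: with it, the semantics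
   of the tests needs no assumption that the arguments are below [n]. *)
Definition bitv a b := tp (minn N (k.+1 + a * n + b)) == Some true.
Definition adjv a b := if b < a then bitv a b else if a < b then bitv b a else false.
Definition candv (qs ws : seq nat) v :=
  (v \in qs) || (v \notin ws) && all (adjv v) qs.
Definition candf h p := candv (map p qheads) (map p wheads) (p h).

(** [f] is evaluated at the initial positions and [W] at the final ones, where the heads hold the
    witness found. *)
Definition finds P (f : pos -> bool) M (W : pos -> Prop) :=
  forall p, frame n p -> bounded p ->
  wp tp P (fun b p' => [/\ b = f p, agree M p p' & b -> W p']) p.
Definition tests P f M := finds P f M (fun _ => True).

Lemma tests_sub P f M M' : {subset M <= M'} -> tests P f M -> tests P f M'.
Proof.
move=> S T p F b; apply: wp_mono (T p F b) _ => c p' [-> A _]; split=> //.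
exact: agree_sub A.
Qed.

Lemma tests_ext P f f' M : f =1 f' -> tests P f M -> tests P f' M.
Proof. by move=> /funext->. Qed.

Lemma tests_ret b M : tests (ret _ b) (fun _ => b) M.
Proof. by move=> p _ _; apply: wp_ret. Qed.

Lemma tests_ite P1 P2 P3 f g g' M : ~~ has (mem M) permanent ->
    indep M g -> indep M g' -> tests P1 f M -> tests P2 g M -> tests P3 g' M ->
  tests (Ite P1 P2 P3) (fun p => if f p then g p else g' p) M.
Proof.
move=> pM Ig Ig' T1 T2 T3 p F b; apply: wp_ite.
apply: wp_mono (wp_bound (T1 p F b) b) _ => c p1 [[-> A _] b1].
have F1 := frame_agree pM A F.
have [fT|fF] := ifP.
  apply: wp_mono (T2 p1 F1 b1) _ => c2 p2 [-> A2 _]; rewrite (Ig p p1) //; split=> //.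
  exact: agree_trans A2.
apply: wp_mono (T3 p1 F1 b1) _ => c2 p2 [-> A2 _]; rewrite (Ig' p p1) //; split=> //.
exact: agree_trans A2.
Qed.

Lemma tests_memT l h M : tests (memT l h) (fun p => p h \in map p l) M.
Proof.
move=> p _ _; apply: wp_test; split=> //.
rewrite -has_pred1 has_map; apply: eq_has => h' /=.
by rewrite !ffunE /= -eqn_leq eq_sym.
Qed.

Lemma tests_adjT h h' : h \notin temps -> h' \notin temps ->
  tests (adjT h h') (fun p => adjv (p h) (p h')) temps.
Proof.
move=> hT h'T p [z0 eN bE nE] b.
have B h1 h2 : h1 \notin temps -> h2 \notin temps ->
  wp tp (pseq (addr h1 h2) bit)
    (fun c p' => [/\ c = bitv (p h1) (p h2), agree temps p p' & c -> True]) p.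
  move=> h1T h2T; apply: wp_seq; apply: wp_mono (wp_addr h1T h2T z0 eN b) _ => _ p1 [A1 T1].
  by apply: wp_test; split=> //; rewrite view2 /= T1 bE nE.
rewrite /adjv; apply: wp_ite; apply: wp_tlt; case: ifP => _; first exact: B.
apply: wp_ite; apply: wp_tlt; case: ifP => _; first exact: B.
exact: wp_ret.
Qed.

Lemma tests_allT h l : h \notin temps -> ~~ has (mem temps) l ->
  tests (allT h l) (fun p => all (adjv (p h)) (map p l)) temps.
Proof.
move=> hT; elim: l => [|h' l IH]; first by move=> _; apply: tests_ret.
rewrite [has _ _]/= negb_or => /andP[h'T lT].
apply: (@tests_ext _ (fun p => if adjv (p h) (p h') then all (adjv (p h)) (map p l) else false)).
  by move=> p /=; case: (adjv _ _).
apply: tests_ite => //; [|exact: tests_adjT|exact: IH|exact: tests_ret].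
move=> p p' A; rewrite A //; congr all; apply/eq_in_map => i il; apply: A.
by move/hasPn: lT; apply.
Qed.

Lemma qheadsP h : h \in qheads -> exists i, h = inr (inl i).
Proof. by case/mapP => i _ ->; exists i. Qed.

Lemma wheadsP h : h \in wheads -> exists i, h = inr (inr i).
Proof. by case/mapP => i _ ->; exists i. Qed.

Definition fixedb h := if h is inl _ then true else false.

Lemma map_heads M p p' : all fixedb M -> agree M p p' ->
  map p' qheads = map p qheads /\ map p' wheads = map p wheads.
Proof.
move=> /allP MF A; split; apply/eq_in_map => h.
  by case/qheadsP => i ->; apply: A; apply/negP => /MF.
by case/wheadsP => i ->; apply: A; apply/negP => /MF.
Qed.

Lemma indep_candf h M : all fixedb M -> h \notin M -> indep M (candf h).
Proof. by move=> MF hM p p' A; rewrite /candf; have [-> ->] := map_heads MF A; rewrite A. Qed.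

Lemma candfE h M p p' : all fixedb M -> agree M p p' -> h \notin M -> candf h p' = candf h p.
Proof. by move=> MF A hM; apply: (indep_candf MF hM). Qed.

Lemma tests_inT h : h \notin temps -> tests (inT h) (candf h) temps.
Proof.
move=> hT.
apply: (@tests_ext _ (fun p => if p h \in map p qheads then true else
   if p h \in map p wheads then false else all (adjv (p h)) (map p qheads))).
  by move=> p; rewrite /candf /candv; case: (_ \in map p qheads); case: (_ \in map p wheads).
have Iall : indep temps (fun p => all (adjv (p h)) (map p qheads)).
  by move=> p p' A; have [-> _] := @map_heads temps _ _ isT A; rewrite A.
apply: tests_ite => //; [|exact: tests_memT|exact: tests_ret|].
  by move=> p p' A; have [-> ->] := @map_heads temps _ _ isT A; rewrite !A.
apply: tests_ite => //; [exact: tests_memT|exact: tests_ret|].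
apply: tests_allT => //; apply/hasPn => h' /qheadsP[i ->] //.
Qed.

Definition exf h (f : pos -> bool) p := [exists v : 'I_n, f (upd p h v)].

Lemma agree_upd_upd M p p' h v : agree (h :: M) p p' -> agree M (upd p h v) (upd p' h v).
Proof.
move=> A h' h'M; rewrite /upd; case: eqP => // /eqP hh'.
by rewrite A // inE negb_or hh'.
Qed.

Lemma indep_exf h f M : indep M f -> indep (h :: M) (exf h f).
Proof.
move=> If p p' A; apply: eq_existsb => v; apply: If; exact: agree_upd_upd.
Qed.

(** The loop invariant [no] says that [f] fails for all smaller vertices; it becomes the minimality
    clause on which the optimality of the search rests. *)
Lemma finds_exT h P f M W : h \notin M -> ~~ has (mem (h :: M)) permanent ->
    indep M f -> finds P f M W ->
  finds (exT h P) (exf h f) (h :: M)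
    (fun p' => [/\ W p', p' h < n & forall v, v < p' h -> ~~ f (upd p' h v)]).
Proof.
move=> hM pM If T p F b; apply: wp_seq; apply: wp_copy; apply: wp_seq.
have [z0 eN bE nE] := F; rewrite z0.
have nN : n <= N by rewrite -nE b.
have hn' : h != hn by move: pM => /hasPn/(_ hn isT); rewrite inE negb_or eq_sym => /andP[].
have pM' : ~~ has (mem M) permanent.
  by apply: permanent_sub pM => i iM; rewrite inE iM orbT.
pose no j := forall v, v < j -> ~~ f (upd p h v).
pose J m p1 := [/\ m = n - p1 h, p1 h <= n, agree (h :: M) p p1, bounded p1 & no (p1 h)].
apply: (@wp_mono _ _ _ (fun _ p2 => agree (h :: M) p p2 /\
    ((p2 h = n /\ no n) \/ [/\ p2 h < n, f (upd p h (p2 h)), no (p2 h) & W p2]))); last first.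
  move=> _ p2 [A2 H2]; apply: wp_tlt; have [_ _ _ n2] := frame_agree pM A2 F; rewrite n2.
  case: H2 => [[hE Hno]|[hlt fT Hno W2]].
    rewrite hE ltnn; split=> //; apply/esym/negbTE/existsPn => v; exact: Hno.
  rewrite hlt; split=> //; first by apply/esym/existsP; exists (Ordinal hlt).
  move=> _; split=> // v vlt.
  rewrite (If (upd p h v)); [exact: Hno|exact: agree_upd_upd].
apply: (@wp_loop _ _ _ J _ _ n); last first.
  rewrite /J upd_same subn0; split=> //.
    by apply: agree_upd; rewrite inE eqxx.
  by move=> i; rewrite /upd; case: eqP.
move=> m p1 [mE le1 A1 b1 no1]; apply: wp_ite; apply: wp_tlt.
have F1 := frame_agree pM A1 F; have [z1 e1 bb1 n1] := F1; rewrite n1.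
have [lt|ge] := ltnP (p1 h) n; last first.
  have hE : p1 h = n by apply/eqP; rewrite eqn_leq le1.
  by apply: wp_ret; split=> //; left; rewrite -hE.
apply: wp_ite; apply: wp_mono (wp_bound (T p1 F1 b1) b1) _ => c p2 [[cE A2 W2] b2].
have h2 : p2 h = p1 h by apply: A2.
have A12 : agree (h :: M) p p2.
  apply: agree_trans A1 _; apply: agree_sub A2 => i iM; by rewrite inE iM orbT.
have fE : f (upd p h (p1 h)) = f p1.
  by rewrite -(If _ _ (agree_upd_upd (p1 h) A1)) upd_eta.
have F2 := frame_agree pM' A2 F1; have [_ _ _ n2] := F2.
rewrite cE; case: ifP => fT.
  apply: wp_ret; split=> //; right; rewrite h2 fE fT; split=> //; apply: W2.
  by rewrite cE.
apply: (@wp_mv _ _ _ _ hn); first by rewrite /= h2 n2.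
exists (n - (p1 h).+1); first by rewrite mE; lia.
rewrite /J upd_same h2 /=; split=> //.
- by apply: agree_trans A12 _; apply: agree_upd; rewrite inE eqxx.
- by move=> i; rewrite /upd; case: eqP => // _; lia.
move=> v; rewrite ltnS leq_eqVlt => /orP[/eqP->|]; last exact: no1.
by rewrite fE fT.
Qed.

Lemma tests_exT h P f M : h \notin M -> ~~ has (mem (h :: M)) permanent ->
  indep M f -> tests P f M -> tests (exT h P) (exf h f) (h :: M).
Proof.
move=> hM pM If T p F b; apply: wp_mono (finds_exT hM pM If T F b) _.
by move=> c p' [].
Qed.

Lemma indep_foldr_exf l f M : indep M f -> indep (l ++ M) (foldr exf f l).
Proof. by move=> If; elim: l => //= h l IH; apply: indep_exf. Qed.

Lemma finds_exs l P f M : uniq l -> ~~ has (mem M) l -> ~~ has (mem (l ++ M)) permanent ->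
    indep M f -> tests P f M ->
  finds (foldr exT P l) (foldr exf f l) (l ++ M)
    (fun p' => f p' /\ forall h, h \in l -> p' h < n).
Proof.
move=> + + + If T; elim: l => [|h l IH] /=.
  move=> _ _ _ p F b; apply: wp_mono (T p F b) _ => c p' [cE A _]; split=> //.
  by rewrite cE => fp; split=> //; rewrite (If p).
move=> /andP[hl ul]; rewrite negb_or => /andP[hM lM] pM.
have pM' : ~~ has (mem (l ++ M)) permanent.
  by apply: permanent_sub pM => i iM; rewrite inE iM orbT.
have hlM : h \notin l ++ M by rewrite mem_cat negb_or hl.
have := finds_exT hlM pM (indep_foldr_exf (l := l) If) (IH ul lM pM').
move=> H p F b; apply: wp_mono (H p F b) _ => c p' [-> A W]; split=> // /W [[fp L] hn' _].
by split=> // h'; rewrite inE => /orP[/eqP->|/L].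
Qed.

Lemma foldr_exf_intro l (f : pos -> bool) p p1 : agree l p p1 -> (forall h, h \in l -> p1 h < n) -> f p1 ->
  foldr exf f l p.
Proof.
elim: l p => [|h l IH] p A L fp /=.
  by have -> : p = p1 by apply/funext => h; rewrite A.
apply/existsP; have hlt : p1 h < n by apply: L; rewrite inE eqxx.
exists (Ordinal hlt); apply: IH => // [|h' h'l]; last by apply: L; rewrite inE h'l orbT.
by rewrite -{2}(upd_eta p1 h); apply: agree_upd_upd.
Qed.

Definition badf : pos -> bool := exf hx (exf hy (fun p =>
  [&& p hx != p hy, candf hx p, candf hy p & ~~ adjv (p hx) (p hy)])).
Definition countf p := count (fun v => ~~ candv (map p qheads) (map p wheads) v) (iota 0 n).
Definition goodf p := ~~ badf p && (countf p == p hm).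

Lemma tests_badT : tests badT badf [:: hx, hy & temps].
Proof.
rewrite /badf; set f := (X in exf hy X).
have If : indep temps f.
  move=> p p' A; by rewrite /f !(candfE (M := temps) isT A) // !A.
have Tf : tests (Ite (memT [:: hx] hy) (ret _ false)
    (Ite (inT hx) (Ite (inT hy) (Ite (adjT hx hy) (ret _ false) (ret _ true)) (ret _ false))
       (ret _ false))) f temps.
  apply: (@tests_ext _ (fun p => if p hy \in map p [:: hx] then false else
    if candf hx p then if candf hy p then if adjv (p hx) (p hy) then false else true
       else false else false)).
    by move=> p; rewrite /f inE eq_sym; case: (p hx == p hy).
  have Ia : indep temps (fun p => if adjv (p hx) (p hy) then false else true).
    by move=> p p' A; rewrite !A.
  have Ib : indep temps (fun p => if candf hy p then
      if adjv (p hx) (p hy) then false else true else false).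
    by move=> p p' A; rewrite (Ia _ _ A) (candfE (M := temps) isT A).
  apply: tests_ite => //; [|exact: tests_memT|exact: tests_ret|].
    by move=> p p' A; rewrite (Ib _ _ A) (candfE (M := temps) isT A).
  apply: tests_ite => //; [exact: tests_inT| |exact: tests_ret].
  apply: tests_ite => //; [exact: tests_inT| |exact: tests_ret].
  by apply: tests_ite => //; [exact: tests_adjT|exact: tests_ret|exact: tests_ret].
apply: tests_exT => //; last by apply: tests_exT.
exact: indep_exf.
Qed.

Lemma tests_countT : tests countT (fun p => countf p == p hm) [:: hc, hx & temps].
Proof.
set M := [:: hc, hx & temps].
move=> p F b; have [z0 eN bE nE] := F; apply: wp_seq; apply: wp_copy; apply: wp_seq.
rewrite z0; set p0 := upd p hc 0.
have A0 : agree M p p0 by apply: agree_upd.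
have F0 : frame n p0 by apply: frame_agree A0 F.
have b0 : bounded p0 by move=> i; rewrite /p0 /upd; case: eqP.
pose cnt j := count (fun v => ~~ candv (map p qheads) (map p wheads) v) (iota 0 j).
pose Inv j p1 := agree M p p1 /\ p1 hc = cnt j.
have H : wp tp (for_ hx hn (Ite (inT hx) (ret _ true) (mv true hc)))
    (fun _ p2 => [/\ p2 hx = p0 hn, p2 hn = p0 hn & Inv (p0 hn) p2]) p0.
  apply: wp_for => //.
    by split; [apply: agree_trans A0 _; apply: agree_upd|].
  move=> j p1 jn xj nE1 b1 [A1 c1].
  have F1 : frame n p1 by apply: frame_agree A1 F.
  have cntS : cnt j.+1 = cnt j + ~~ candf hx p1.
    rewrite /cnt -(addn1 j) iotaD count_cat /= addn0 add0n; congr (_ + nat_of_bool (~~ _)).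
    by rewrite /candf; have [-> ->] := @map_heads M p p1 isT A1; rewrite xj.
  apply: wp_ite; apply: wp_mono (wp_bound (tests_inT (h := hx) isT F1 b1) b1) _.
  move=> c p2 [[-> A2 _] b2].
  have A12 : agree M p p2.
    by apply: agree_trans A1 _; apply: agree_sub A2 => i; rewrite !inE orbC => ->; rewrite ?orbT.
  have U q : agree M p q -> agree M p (upd q hx j.+1).
    by move=> Aq; apply: agree_trans Aq _; apply: agree_upd.
  have c2 : p2 hc = cnt j by rewrite A2.
  have n2 : p2 hn = p0 hn by rewrite A2.
  case: ifP => inx.
    apply: wp_ret; split=> //; first by rewrite A2.
    by split; [exact: U|rewrite upd_neq // c2 cntS inx addn0].
  apply: (@wp_mv _ _ _ _ hn).
    rewrite /= n2 c2; apply: leq_ltn_trans jn.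
    by rewrite /cnt (leq_trans (count_size _ _)) ?size_iota.
  split; first by rewrite upd_neq // A2.
  - by rewrite upd_neq.
  split; last by rewrite upd_neq // upd_same c2 cntS inx addn1.
  by apply: U; apply: agree_trans A12 _; apply: agree_upd.
apply: wp_mono (wp_bound H b0) _ => _ p1 [[_ _ [A1 c1]] b1].
have F1 : frame n p1 by apply: frame_agree A1 F.
apply: wp_mono (tests_memT [:: hm] hc M F1 b1) _ => c p2 [-> A2 _]; split=> //.
  by rewrite inE c1 !A1 //; have [_ _ _ ->] := F0.
exact: agree_trans A2.
Qed.

Lemma goodfP : indep [:: hc, hx, hy & temps] goodf /\
  tests goodT goodf [:: hc, hx, hy & temps].
Proof.
set M := [:: hc, hx, hy & temps].
have Ic : indep M (fun p => countf p == p hm).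
  by move=> p p' A; rewrite /countf; have [-> ->] := @map_heads M p p' isT A; rewrite A.
have Ib : indep M badf.
  move=> p p' A; rewrite /badf /exf; apply: eq_existsb => v; apply: eq_existsb => v'.
  have A' : agree (hc :: temps) (upd (upd p hx v) hy v') (upd (upd p' hx v) hy v').
    do 2 apply: agree_upd_upd; apply: agree_sub A => i.
    by rewrite !inE => /or4P[->|->|->|->]; rewrite ?orbT.
  by rewrite !A' // !(candfE (M := hc :: temps) isT A').
split; first by move=> p p' A; rewrite /goodf (Ib _ _ A) (Ic _ _ A).
apply: (@tests_ext _ (fun p => if badf p then false else countf p == p hm)).
  by move=> p; rewrite /goodf; case: (badf p).
apply: tests_ite => //; last 2 first.
- exact: tests_ret.
- apply: tests_sub tests_countT => i; rewrite !inE => /or3P[->|->|->]; by rewrite ?orbT.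
apply: tests_sub tests_badT => i; rewrite !inE => /or3P[->|->|->]; by rewrite ?orbT.
Qed.

Definition goodv (qs ws : seq nat) m :=
  ~~ [exists x : 'I_n, exists y : 'I_n,
        [&& x != y :> nat, candv qs ws x, candv qs ws y & ~~ adjv x y]]
  && (count (fun v => ~~ candv qs ws v) (iota 0 n) == m).

Lemma goodfE p : goodf p = goodv (map p qheads) (map p wheads) (p hm).
Proof.
rewrite /goodf /goodv /countf; congr (~~ _ && _).
rewrite /badf /exf; apply: eq_existsb => x; apply: eq_existsb => y.
set p' := upd _ _ _.
have A : agree [:: hx; hy] p p'.
  apply: (@agree_trans _ _ (upd p hx x)); exact: agree_upd.
have [Eq Ew] := @map_heads [:: hx; hy] p p' isT A.
rewrite /candf Eq Ew; have -> : p' hx = x by rewrite /p' upd_neq // upd_same.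
by have -> : p' hy = y by rewrite /p' upd_same.
Qed.

Lemma uniq_heads : uniq (qheads ++ wheads).
Proof.
rewrite cat_uniq; apply/and3P; split.
- by rewrite map_inj_uniq ?enum_uniq // => i j [].
- by apply/hasPn => h /wheadsP[i ->]; apply/negP => /qheadsP[].
- by rewrite map_inj_uniq ?enum_uniq // => i j [].
Qed.

Lemma not_fixed_heads h : fixedb h -> h \notin qheads ++ wheads.
Proof.
move=> hF; rewrite mem_cat; apply/norP; split; apply/negP.
  by case/qheadsP => i E; rewrite E in hF.
by case/wheadsP => i E; rewrite E in hF.
Qed.

(** Any good triple makes the inner search succeed with [hm] on its [m], so the first successful
    value of [hm] is at most [m]. *)
Lemma wp_search p : frame n p -> bounded p ->
  wp tp search (fun _ p' => frame n p' /\
    forall qs ws m, size qs = d -> size ws = d ->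
      (forall v, v \in qs ++ ws -> v < n) -> m < n -> goodv qs ws m ->
    goodv (map p' qheads) (map p' wheads) (p' hm) /\ p' hm <= m) p.
Proof.
move=> F b; have [Ig Tg] := goodfP; set M := [:: hc, hx, hy & temps] in Ig Tg.
set l := qheads ++ wheads; set f := foldr exf goodf l.
have lM : ~~ has (mem M) l.
  apply/hasPn => h; apply: contraL => hM; apply: not_fixed_heads.
  by move: hM; case: h.
have pM : ~~ has (mem (hm :: l ++ M)) permanent.
  apply/hasPn => h hp; change (h \notin hm :: (l ++ M)).
  rewrite in_cons mem_cat !negb_or; apply/and3P; split.
  - by move: hp; rewrite !inE => /or4P[]/eqP->.
  - by apply: not_fixed_heads; move: hp; rewrite !inE => /or4P[]/eqP->.
  - by move: hp; rewrite !inE => /or4P[]/eqP->.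
have pM' : ~~ has (mem (l ++ M)) permanent.
  by apply: permanent_sub pM => i iM; rewrite inE iM orbT.
have hml : hm \notin l ++ M by rewrite mem_cat negb_or not_fixed_heads.
have If := indep_foldr_exf (l := l) Ig.
have := finds_exT hml pM If (finds_exs uniq_heads lM pM' Ig Tg).
move=> H; apply: wp_mono (H p F b) _ => c p' [-> A W].
split; first exact: frame_agree A F.
move=> qs ws m sq sw qwn mn gv.
have intro_f p0 : f (upd p0 hm m).
  pose p1 : pos := fun h => match h with
    | inl i => upd p0 hm m (inl i)
    | inr (inl i) => nth 0 qs i
    | inr (inr i) => nth 0 ws i
    end.
  have qE : map p1 qheads = qs.
    rewrite -map_comp; apply: (@eq_from_nth _ 0); rewrite size_map size_enum_ord // => i id.
    by rewrite (nth_map (Ordinal id)) ?size_enum_ord //= nth_enum_ord.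
  have wE : map p1 wheads = ws.
    rewrite -map_comp; apply: (@eq_from_nth _ 0); rewrite size_map size_enum_ord // => i id.
    by rewrite (nth_map (Ordinal id)) ?size_enum_ord //= nth_enum_ord.
  apply: (@foldr_exf_intro l goodf _ p1).
  - case=> [h //|[i|i]]; rewrite mem_cat negb_or => /andP[Hq Hw].
      by case/negP: Hq; apply: map_f; rewrite mem_enum.
    by case/negP: Hw; apply: map_f; rewrite mem_enum.
  - move=> h hl; apply: qwn; rewrite -qE -wE -map_cat; exact: map_f.
  by rewrite goodfE qE wE /= upd_same.
have [|[gp' _] mlt noless] := W; first by apply/existsP; exists (Ordinal mn); apply: intro_f.
rewrite goodfE in gp'; split=> //.
by rewrite leqNgt; apply/negP => /noless/negP[]; apply: intro_f.
Qed.

Hypothesis prefixT : forall x, x < k -> tp x = Some true.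
Hypothesis prefixF : tp k = Some false.

Lemma wp_scan p : p hb = 0 -> p he = N -> bounded p ->
  wp tp scan (fun _ p' => p' = upd p hb k.+1) p.
Proof.
move=> b0 eN bN; apply: wp_seq.
apply: (@wp_mono _ _ _ (fun _ p' => p' = upd p hb k)); last first.
  move=> _ p' ->; apply: (@wp_mvE _ _ he N) => //.
    by move=> h; rewrite /upd; case: eqP => // _; rewrite /N; lia.
  by rewrite upd_same upd_upd; congr upd; rewrite /N; lia.
pose J m p1 := exists j, [/\ m = k - j, j <= k & p1 = upd p hb j].
apply: (@wp_loop _ _ _ J _ _ k); last first.
  by exists 0; rewrite subn0; split=> //; have := upd_eta p hb; rewrite b0 => ->.
move=> m p1 [j [-> jk ->]]; apply: wp_ite; apply: wp_test; rewrite view2 /= upd_same.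
have [lt|ge] := ltnP j k.
  rewrite (prefixT lt) eqxx; apply: (@wp_mv _ _ _ _ he).
    by rewrite /= upd_same upd_neq // eN /N; lia.
  by exists (k - j.+1); [lia|exists j.+1; rewrite upd_upd upd_same; split=> //; lia].
have -> : j = k by apply/eqP; rewrite eqn_leq jk.
by rewrite prefixF /=; apply: wp_ret.
Qed.

Lemma wp_find_n p : frame 0 p -> bounded p ->
  wp tp find_n (fun _ p' => frame n p' /\ bounded p') p.
Proof.
move=> F b.
pose J m p1 := exists j, [/\ m = n - j, j <= n, frame j p1 & bounded p1].
apply: (@wp_loop _ _ _ J _ _ n); last by exists 0; rewrite subn0.
move=> m p1 [j [-> jn F1 b1]]; have [z1 e1 bb1 n1] := F1.
apply: wp_ite; apply: wp_seq.
have H := @wp_addr hn hz p1 isT isT z1 e1 b1.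
apply: wp_mono (wp_bound H b1) _ => _ p2 [[A2 T2] b2].
have F2 : frame j p2 by apply: frame_agree A2 F1.
have [z2 e2 bb2 n2] := F2.
apply: wp_tlt; rewrite T2 e2 bb1 n1 z1 addn0.
case: ifP => lt.
  have jn' : j < n by rewrite ltnNge; apply: contraTN lt => nj; rewrite /N; nia.
  apply: (@wp_mv _ _ _ _ he); first by rewrite /= n2 e2 /N; nia.
  exists (n - j.+1); first by lia.
  exists j.+1; split=> //; last first.
    by move=> h; rewrite /upd; case: eqP => // _; rewrite n2 /= /N; nia.
  by split; rewrite ?upd_same ?n2 // upd_neq.
have jE : j = n by apply/eqP; rewrite eqn_leq jn /=; move/negbT: lt; rewrite /N; nia.
by apply: wp_ret; split=> //; rewrite -jE.
Qed.

Lemma wp_prepare :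
  wp tp prepare (fun _ p' => frame n p' /\
    forall qs ws m, size qs = d -> size ws = d ->
      (forall v, v \in qs ++ ws -> v < n) -> m < n -> goodv qs ws m ->
    goodv (map p' qheads) (map p' wheads) (p' hm) /\ p' hm <= m)
  (fun h => if h == he then N else 0).
Proof.
set p := fun h => _.
have bp : bounded p by move=> h; rewrite /p; case: ifP.
apply: wp_seq; apply: wp_mono (wp_bound (@wp_scan p erefl erefl bp) bp) _.
move=> _ p1 [-> b1]; apply: wp_seq.
have F1 : frame 0 (upd p hb k.+1) by split.
apply: wp_mono (wp_find_n F1 b1) _ => _ p2 [F2 b2].
exact: wp_search.
Qed.

End Semantics.

(** Only entries below the diagonal are read. Their row number is at least 1, so their cells come
    after the first [n] cells, the ones that the output overwrites. *)
Lemma adjv_ext k n tp tp' : (forall x, n <= x -> tp' x = tp x) ->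
  adjv k n tp' = adjv k n tp.
Proof.
move=> E; apply/funext => a; apply/funext => b; rewrite /adjv /bitv.
case: ltnP => [ba|_]; first by rewrite E //; nia.
by case: ltnP => [ab|//]; rewrite E //; nia.
Qed.

Lemma candf_ext k n tp tp' : (forall x, n <= x -> tp' x = tp x) ->
  candf k n tp' = candf k n tp.
Proof. by move=> E; rewrite /candf /candv (adjv_ext _ E). Qed.

(** * Writing the answer over the input *)

Section Output.

Variables (k n : nat) (tp : nat -> option bool) (p : pos).
Let N := k.+1 + n * n.
Hypotheses (F : frame k n n p) (bN : forall h, p h <= N).
Let M := hx :: temps.
(** Time of one membership test, from [big_time]; the output loop writes and is timed round by
    round. *)
Let K := #|pst (inT hx)| * N.+1 ^ #|{: head}|.
Let inp := candv k n tp (map p qheads) (map p wheads).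

Lemma big_write h b (p1 : pos) tp1 : p1 h < p1 he ->
  big (write h b) (p1, tp1) 1 true (p1, upd tp1 (p1 h) (Some b)).
Proof.
move=> he'.
have <- : mact (Write h b) (p1, tp1) = (p1, upd tp1 (p1 h) (Some b)).
  by rewrite /mact; case: ifP => // /negbT/existsPn/(_ he); rewrite beyondE /= he'.
exact: BPrim.
Qed.

Lemma big_mv b h h' (p1 : pos) tp1 : pbeyond p1 b h h' ->
  big (mv b h) (p1, tp1) 1 true (upd p1 h (shift b (p1 h)), tp1).
Proof. by move=> hh'; rewrite -(mact_move _ hh'); apply: BPrim. Qed.

Lemma big_test c (s : data head) : big (test c) s 1 (c (view s)) s.
Proof. by have {3}-> : s = mact (Nop _) s by []; apply: BPrim. Qed.

Definition output_loop :=
  Loop (Ite (tlt hx hn) (pseq (Ite (inT hx) (write hx true) (write hx false)) (mv true hx))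
       (ret _ false)).

(** The cells from [n] on keep their contents, so by [candf_ext] the membership tests answer as
    before the first write. A round costs the test and three further steps. *)
Lemma big_output_loop m p1 tp1 : n - p1 hx = m -> p1 hx <= n -> agree M p p1 ->
    (forall h, p1 h <= N) ->
    (forall x, x < p1 hx -> tp1 x = Some (inp x)) -> (forall x, n <= x -> tp1 x = tp x) ->
  exists t p' tp', [/\ big output_loop (p1, tp1) t false (p', tp') /\ t <= m * (K + 3) + 2,
    agree M p p', (forall h, p' h <= N),
    (forall x, x < n -> tp' x = Some (inp x)) & forall x, n <= x -> tp' x = tp x].
Proof.
elim: m p1 tp1 => [|m IH] p1 tp1 mE le A1 b1 In1 Out1; have [z0 eN bE nE] := F.
all: have n1 : p1 hn = n by rewrite A1.
  have hxE : p1 hx = n by lia.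
  exists 2, p1, tp1; split=> //; last by rewrite -hxE.
  split=> //; apply: BLoopF; apply: (@BIte _ _ _ _ _ 1 false (p1, tp1) 1).
    by have := @big_test (fun v => beyond v true hx hn) (p1, tp1);
      rewrite beyondE /= n1 hxE ltnn.
  exact: (@big_test (fun _ => false)).
have lt : p1 hx < n by lia.
have lte : p1 hx < p1 he by rewrite [p1 he]A1 // eN /N; nia.
have F1 : frame k n n p1 by apply: frame_agree A1 F.
have [t [b [p2 [B2 [[bE2 A2 _] b2]]]]] :=
  wp_bound (tests_inT (h := hx) tp1 isT F1 b1) b1.
have tK : t <= K by apply: big_time (readonly_inT hx) B2 b1.
have A12 : agree M p p2.
  by apply: agree_trans A1 _; apply: agree_sub A2 => i iT; rewrite inE iT orbT.
have x2 : p2 hx = p1 hx by rewrite A2.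
have bE3 : b = inp (p1 hx).
  rewrite bE2 (candf_ext _ Out1) /candf.
  by have [-> ->] := @map_heads M _ _ isT A1.
set tp2 := upd tp1 (p2 hx) (Some b); set p3 := upd p2 hx (p2 hx).+1.
have A3 : agree M p p3 by apply: agree_trans A12 _; apply: agree_upd.
have x3 : p3 hx = (p1 hx).+1 by rewrite /p3 upd_same x2.
have b3 h : p3 h <= N.
  by rewrite /p3 /upd; case: eqP => // _; rewrite x2 /N; nia.
have [||||t' [p' [tp' [[B' t'K] A' b' In' Out']]]] := IH p3 tp2 _ _ A3 b3.
- by rewrite x3; lia.
- by rewrite x3.
- move=> x; rewrite x3 ltnS leq_eqVlt /tp2 /upd x2 bE3 => /orP[/eqP->|xl].
    by rewrite eqxx.
  by case: (x =P p1 hx) => [->//|_]; apply: In1.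
- move=> x nx; rewrite /tp2 /upd x2; case: (x =P p1 hx) => [xE|_]; last exact: Out1.
  by rewrite -xE in lt; lia.
exists ((1 + ((t + 1) + 1)) + t'), p', tp'; split=> //; split; last by lia.
apply: (@BLoopT _ _ _ _ (p3, tp2)) B'.
apply: (@BIte _ _ _ _ _ 1 true (p1, tp1)).
  by have := @big_test (fun v => beyond v true hx hn) (p1, tp1); rewrite beyondE /= n1 lt.
apply: (@BIte _ _ _ _ _ (t + 1) true (p2, tp2)).
  apply: (BIte B2); rewrite /tp2; case: (b); apply: big_write;
  by rewrite x2 A2.
by apply: (@big_mv true hx hn); rewrite /= x2 A2 // n1.
Qed.

Lemma big_output : exists t p' tp', [/\ big output (p, tp) t false (p', tp') /\
      t <= #|pst (copy hx hz)| * N.+1 ^ #|{: head}| + (n * (K + 3) + 2),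
    agree M p p', (forall h, p' h <= N),
    (forall x, x < n -> tp' x = Some (inp x)) & forall x, n <= x -> tp' x = tp x].
Proof.
have [z0 eN bE nE] := F.
have [t0 [b0 [p1 [B1 [p1E b1]]]]] : wp tp (copy hx hz)
    (fun _ p' => p' = upd p hx 0 /\ forall h, p' h <= N) p.
  by apply: wp_copy; rewrite z0; split=> // h; rewrite /upd; case: eqP.
have t0K := big_time (readonly_copy hx hz) B1 bN.
have x1 : p1 hx = 0 by rewrite p1E upd_same.
have [|||||t [p' [tp' [[B' tK] A' b' In' Out']]]] := @big_output_loop n p1 tp _ _ _ b1.
- by rewrite x1 subn0.
- by rewrite x1.
- by rewrite p1E; apply: agree_upd.
- by move=> x; rewrite x1.
- by [].
exists (t0 + t), p', tp'; split=> //; split; last by rewrite leq_add.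
by apply: (BIte B1); case: (b0).
Qed.

End Output.

Lemma wp_park tp p l N : (forall h, p h <= N) -> p he = N ->
  wp tp (park l) (fun _ p' => (forall h, h \in l -> p' h = N) /\
    forall h, h \notin l -> p' h = p h) p.
Proof.
elim: l p => [|h l IH] p bN eN; first by apply: wp_ret.
apply: wp_seq; apply: wp_moveto => /=.
set p1 := if _ then _ else _.
have p1E : p1 = upd p h N.
  rewrite /p1 eN; case: ltnP => // Nh; rewrite -{1}(upd_eta p h); congr upd.
  by apply/eqP; rewrite eqn_leq bN.
have b1 i : p1 i <= N by rewrite p1E /upd; case: eqP.
have e1 : p1 he = N by rewrite p1E /upd; case: eqP.
apply: wp_mono (IH p1 b1 e1) _ => _ p' [H1 H2]; split=> h'.
  rewrite inE; have [h'l _|h'l] := boolP (h' \in l); first exact: H1.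
  by rewrite orbF => /eqP hE; rewrite H2 // p1E hE upd_same.
by rewrite inE negb_or => /andP[hh' h'l]; rewrite H2 // p1E upd_neq.
Qed.

Definition algorithm_weight :=
  #|pst prepare| + #|pst (copy hx hz)| + #|pst (inT hx)| + #|pst (park others)| + 3.

Theorem algorithm_spec k n (tp : nat -> option bool) :
    (forall x, x < k -> tp x = Some true) -> tp k = Some false ->
  let N := k.+1 + n * n in
  exists t b p' tp' qs ws m0,
    [/\ big algorithm (fun h => if h == he then N else 0, tp) t b (p', tp'),
        t <= algorithm_weight * (n + 2) * N.+1 ^ #|{: head}|,
        (forall h, p' h = if h == hn then n else N),
        (forall x, x < n -> tp' x = Some (candv k n tp qs ws x)) &
        forall qs' ws' m, size qs' = d -> size ws' = d ->
          (forall v, v \in qs' ++ ws' -> v < n) -> m < n -> goodv k n tp qs' ws' m ->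
        goodv k n tp qs ws m0 /\ m0 <= m].
Proof.
move=> kT kF N; set p := fun h => _.
have bp h : p h <= N by rewrite /p; case: ifP.
have [t1 [b1 [p1 [B1 [[F1 H1] bN1]]]]] := wp_bound (wp_prepare n kT kF) bp.
have t1K := big_time readonly_prepare B1 bp.
have [t2 [p2 [tp2 [[B2 t2K] A2 bN2 In2 Out2]]]] := big_output tp F1 bN1.
have [z0 eN bE nE] := F1.
have e2 : p2 he = N by rewrite A2.
have [t3 [b3 [p3 [B3 [H3 H3']]]]] := wp_park tp2 others bN2 e2.
have t3K := big_time (readonly_park others) B3 bN2.
exists (t1 + (t2 + t3)), b3, p3, tp2, (map p1 qheads), (map p1 wheads), (p1 hm); split=> //.
- apply: (BIte B1); have B23 : big (pseq output (park others)) (p1, tp) (t2 + t3) b3 (p3, tp2).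
    exact: (BIte B2).
  by case: (b1).
- move: t1K t2K t3K; rewrite /algorithm_weight.
  have : 0 < N.+1 ^ #|{: head}| by rewrite expn_gt0.
  set e := _ ^ _; set c1 := #|pst prepare|; set c2 := #|pst (copy _ _)|.
  set c3 := #|pst (inT _)|; set c4 := #|pst (park _)|.
  move: c1 c2 c3 c4 e => c1 c2 c3 c4 e; nia.
- move=> h; case: ifP => [/eqP->|hn'].
    by rewrite H3' ?A2 // mem_filter eqxx.
  by apply: H3; rewrite mem_filter hn' mem_enum.
Qed.

End Algorithm.

(** * The Turing machine *)

Section Machine.

Variable d : nat.

Notation he := (inl (@Ordinal 11 1 isT) : head d).
Notation hn := (inl (@Ordinal 11 3 isT) : head d).

Definition machine : TM :=
  tm_of (TInit (head d) (pst (algorithm d)))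
    (sim_delta (pstart (algorithm d)) (@ptr _ (algorithm d)) he).

Lemma nth_flatten_const (A B : Type) (x0 : B) (y0 : A) (f : A -> seq B) (s : seq A) n a b :
  (forall y, size (f y) = n) -> a < size s -> b < n ->
  nth x0 (flatten (map f s)) (a * n + b) = nth x0 (f (nth y0 s a)) b.
Proof.
move=> sf; elim: s a => [//|y s IH] [|a] /= al bl; rewrite nth_cat sf.
  by rewrite bl.
by rewrite mulSn -addnA ltnNge leq_addr /= addKn IH.
Qed.

(** * The machine on the encoding of a graph *)

Section Graph.

Variables (k n : nat) (g : 'I_n -> 'I_n -> bool).
Let w := enc_input k g.
Let N := k.+1 + n * n.

Lemma size_enc_input : size w = N.
Proof.
rewrite /w /enc_input size_cat size_nseq /= addnS /N addSn; congr (_ + _).+1.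
rewrite size_flatten /shape -map_comp.
rewrite (eq_map (g := fun _ : 'I_n => n)) => [|i]; last first.
  by rewrite /= size_map size_enum_ord.
by rewrite sumnE big_map big_const_seq count_predT size_enum_ord iter_addn_0.
Qed.

Lemma input_prefixT x : x < k -> input_tape w x = Some true.
Proof.
move=> xk; rewrite /input_tape size_enc_input /N (leq_trans xk); last by lia.
by rewrite /w /enc_input nth_cat size_nseq xk nth_nseq xk.
Qed.

Lemma input_prefixF : input_tape w k = Some false.
Proof.
rewrite /input_tape size_enc_input /N ltn_addr //.
by rewrite /w /enc_input nth_cat size_nseq ltnn subnn.
Qed.

Hypothesis g_sym : forall i j, g i j = g j i.

Lemma bitv_input (i j : 'I_n) : bitv k n (input_tape w) i j = g i j.
Proof.
have ijN : i * n + j < n * n by have := ltn_ord i; have := ltn_ord j; nia.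
rewrite /bitv; have -> : minn (k.+1 + n * n) (k.+1 + i * n + j) = k.+1 + (i * n + j) by lia.
rewrite /input_tape size_enc_input /N ltn_add2l ijN.
rewrite /w /enc_input nth_cat size_nseq ltnNge.
have -> : k.+1 + (i * n + j) - k = (i * n + j).+1 by lia.
have -> : k <= k.+1 + (i * n + j) by lia.
rewrite /= (nth_flatten_const false i) ?size_enum_ord // => [|y]; last first.
  by rewrite size_map size_enum_ord.
by rewrite (nth_map i) ?size_enum_ord // !nth_ord_enum; case: (g i j).
Qed.

(** Each pair is looked up below the diagonal only, which suffices by [g_sym]. *)
Lemma adjv_input (i j : 'I_n) : adjv k n (input_tape w) i j = (i != j) && g i j.
Proof.
rewrite /adjv !bitv_input; have [ij|ij|/val_inj->] := ltngtP i j; last by rewrite eqxx.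
  by rewrite g_sym neq_ltn ij.
by rewrite neq_ltn ij orbT.
Qed.

(** The set assigned to [Q] and [W]: [Q] together with its common neighbours outside [W]. *)
Definition cand (qs ws : seq 'I_n) : {set 'I_n} :=
  [set v | (v \in qs) || (v \notin ws) && all (fun q => (v != q) && g v q) qs]%SET.

Let good := goodv k n (input_tape w).
Let candv0 := candv k n (input_tape w).

Lemma inv_cand (qs ws : seq 'I_n) (v : 'I_n) :
  candv0 (map val qs) (map val ws) v = (v \in cand qs ws).
Proof.
rewrite /candv0 /candv inE !(mem_map val_inj); congr (_ || _ && _).
by rewrite all_map; apply: eq_all => q /=; rewrite adjv_input.
Qed.

Lemma goodvP (qs ws : seq nat) m (S : {set 'I_n}) :
  (forall v : 'I_n, (v \in S) = candv0 qs ws v) ->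
  reflect (is_clique g S /\ n - #|S| = m) (good qs ws m).
Proof.
move=> SE.
have cE : count (fun v => ~~ candv0 qs ws v) (iota 0 n) = n - #|S|.
  have -> : n - #|S| = #|~: S| by rewrite [RHS]cardsCs finset.setCK card_ord.
  rewrite -val_enum_ord count_map cardE -size_filter.
  by congr size; rewrite [in RHS]/enum_mem enumT; apply: eq_filter => v /=; rewrite inE SE.
rewrite /good /goodv cE; apply: (iffP andP) => [[/existsPn Cl /eqP Sm]|[Cl /eqP Sm]]; split=> //.
  move=> i j iS jS ij; move: (Cl i) => /existsPn/(_ j).
  by rewrite -!/(candv0 _ _ _) -!SE iS jS ij adjv_input ij /= negbK.
apply/existsPn => i; apply/existsPn => j; rewrite -!/(candv0 _ _ _) -!SE adjv_input.
apply/negP => /and4P[ij iS jS]; have ij' : i != j by [].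
by rewrite ij' (Cl _ _ iS jS ij').
Qed.

(** Minimising the number of omitted vertices maximises the clique. The exponent is the number of
    heads, plus one for the factor [n + 2] and one for the simulation. *)
Theorem machine_spec : exists t (cf : config machine) (S : {set 'I_n}),
  [/\ t <= (algorithm_weight d + 2) * (N + 3) ^ (#|{: head d}| + 2),
      run t (init machine w) = Some cf, outputs cf (enc_set S) &
      forall qs ws, size qs = d -> size ws = d -> is_clique g (cand qs ws) ->
        0 < #|cand qs ws| -> is_clique g S /\ #|cand qs ws| <= #|S|].
Proof.
have [t [b [p' [tp' [qs0 [ws0 [m0 [B tK pE In Opt]]]]]]]] :=
  @algorithm_spec d k n _ input_prefixT input_prefixF.
have R := big_reach B.
have w0 : 0 < size w by rewrite size_enc_input.
have R' : reach (@ptr _ (algorithm d)) (pstart (algorithm d)) (data0 he w) t b (p', tp').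
  by rewrite /data0 size_enc_input.
have [m [cf [mK runE tpE]]] := @simulation _ _ _ _ he w hn t b (p', tp') isT w0 R'.
pose S := [set v : 'I_n | candv0 qs0 ws0 v]%SET.
exists m, cf, S; split=> //.
- apply: leq_trans mK _; rewrite size_enc_input.
  rewrite expnD; have e1 : N.+1 ^ #|{: head d}| <= (N + 3) ^ #|{: head d}|.
    by rewrite leq_exp2r; [lia|apply/card_gt0P; exists he].
  have e0 : 0 < N.+1 ^ #|{: head d}| by rewrite expn_gt0.
  move: tK e1 e0; rewrite -/N; set e := _ ^ _; set e' := (N + 3) ^ #|_|.
  have nN : n + 2 <= N + 3 by rewrite /N; nia.
  move: (algorithm_weight d) e e' nN => c e e' nN tK e1 e0.
  have : t * (N + 3) <= c * (N + 3) * e' * (N + 3).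
    rewrite leq_mul2r; apply/orP; right; apply: leq_trans tK _.
    by apply: leq_mul => //; rewrite leq_mul2l nN orbT.
  nia.
- case: cf runE tpE => [[q tp1] h] _ /= tpE; rewrite /outputs /enc_set size_map size_enum_ord.
  split=> [i ilt|]; rewrite tpE /real.
    (* All heads are at [n] or at the end of the input, so none covers an output cell. *)
    case: existsP => [[j]|_].
      by rewrite pE; case: ifP => _ /eqP; nia.
    rewrite In // (nth_map (Ordinal ilt)) ?size_enum_ord //.
    by rewrite (nth_ord_enum (Ordinal ilt) (Ordinal ilt)) inE.
  by case: existsP => // -[]; exists hn; rewrite pE eqxx.
move=> qs ws sq sw Cl C0.
have G : good (map val qs) (map val ws) (n - #|cand qs ws|).
  by apply/(@goodvP _ _ _ (cand qs ws)) => // v; rewrite inv_cand.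
have Cn : #|cand qs ws| <= n by rewrite -[X in _ <= X]card_ord max_card.
have [] := Opt _ _ _ _ _ _ _ G.
- by rewrite size_map.
- by rewrite size_map.
- by move=> v; rewrite mem_cat => /orP[] /mapP[i _ ->]; apply: ltn_ord.
(* The number of omitted vertices is below [n] because the candidate is non-empty. *)
- by lia.
move=> /(@goodvP _ _ _ S) [|ClS mE le]; first by move=> v; rewrite inE.
split=> //; have : #|S| <= n by rewrite -[X in _ <= X]card_ord max_card.
by lia.
Qed.

End Graph.

End Machine.

(** * Maximum cliques when G' has no large biclique *)

Section Cliques.

Variables (n : nat) (E : {set upair n}).
Implicit Types (K T A B : {set 'I_n}).

Lemma adj_sym i j : adj E i j = adj E j i.
Proof. by rewrite /adj; apply: eq_existsb => e; congr (_ && _); rewrite orbC. Qed.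

Lemma planted_sym K i j : planted E K i j = planted E K j i.
Proof. by rewrite /planted adj_sym eq_sym; congr (_ || _); rewrite [(i \in K) && _]andbC. Qed.

Lemma planted_out K i j : i \notin K -> planted E K i j = adj E i j.
Proof. by move=> iK; rewrite /planted (negPf iK) /= andbF orbF. Qed.

Lemma subset_of_card A r : r <= #|A| -> exists2 B : {set 'I_n}, B \subset A & #|B| = r.
Proof.
move=> rA; exists [set x in take r (enum A)]%SET.
  by apply/fintype.subsetP => x; rewrite inE => /mem_take; rewrite mem_enum.
rewrite cardsE (card_uniqP _) ?take_uniq ?enum_uniq // size_takel //.
by rewrite -cardE.
Qed.

Definition biclique_free r := forall A B, #|A| = r -> #|B| = r -> [disjoint A & B] ->
  exists a b, [/\ a \in A, b \in B & ~~ adj E a b].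

Variables (r : nat) (K : {set 'I_n}).
Hypotheses (r0 : 0 < r) (free : biclique_free r).
Let g := planted E K.

(** Together with [A], any [r] such vertices would form a [K_{r,r}]. *)
Lemma common_neighbors A : #|A| = r ->
  #|[set v | (v \notin A) && [forall a in A, adj E v a]]%SET| < r.
Proof.
move=> Ar; rewrite ltnNge; apply/negP => /subset_of_card[B /fintype.subsetP BS Br].
have [] := free Ar Br.
  rewrite disjoint_sym finset.disjoints_subset; apply/fintype.subsetP => v /BS; by rewrite !inE => /andP[].
move=> a [b [aA /BS]]; rewrite inE => /andP[_ /forall_inP/(_ a aA)].
by rewrite adj_sym => ->.
Qed.

(** For [ws] take the vertices outside [T] that see all of [Q]. Both lists are padded to length [d]
    with a vertex [q0] of [Q]; in [ws] this is harmless because membership in [qs] is decided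
    first. *)
Lemma clique_cand T (Q : {set 'I_n}) d : is_clique g T -> Q \subset T -> 0 < #|Q| <= d ->
    #|[set v | (v \notin T) && [forall q in Q, g v q]]%SET| <= d ->
  exists qs ws, [/\ size qs = d, size ws = d & cand g qs ws = T].
Proof.
set W := [set v | _]%SET => Tcl QT /andP[/card_gt0P[q0 q0Q] Qd] Wd.
pose pad (S : {set 'I_n}) := enum S ++ nseq (d - #|S|) q0.
have size_pad (S : {set 'I_n}) : #|S| <= d -> size (pad S) = d.
  by move=> Sd; rewrite size_cat size_nseq -cardE subnKC.
have mem_pad (S : {set 'I_n}) v : v != q0 -> (v \in pad S) = (v \in S).
  by move=> vq; rewrite mem_cat mem_enum mem_nseq (negPf vq) andbF orbF.
have mem_padQ v : (v \in pad Q) = (v \in Q).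
  have [->|/mem_pad//] := eqVneq v q0; by rewrite mem_cat mem_enum q0Q.
exists (pad Q), (pad W); split; [exact: size_pad|exact: size_pad|].
apply/setP => v; rewrite inE mem_padQ.
have allQ : all (fun q => (v != q) && g v q) (pad Q) =
    [forall q in Q, (v != q) && g v q].
  apply/allP/forall_inP => H q; first by rewrite -mem_padQ; apply: H.
  by rewrite mem_padQ; apply: H.
rewrite allQ; have [vQ|vQ] /= := boolP (v \in Q).
  by rewrite (fintype.subsetP QT).
rewrite mem_pad; last by apply: contraNneq vQ => ->.
rewrite inE; have [vT|vT] /= := boolP (v \in T).
  apply/forall_inP => q qQ; have vq : v != q by apply: contraNneq vQ => ->.
  by rewrite vq; apply: Tcl => //; apply: (fintype.subsetP QT).
apply/negbTE/negP => /andP[/negP nW /forall_inP H]; apply: nW.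
by apply/forall_inP => q /H /andP[].
Qed.

Lemma max_clique_cand : 0 < n -> exists qs ws,
  [/\ size qs = 3 * r, size ws = 3 * r, is_max_clique g (cand g qs ws) & 0 < #|cand g qs ws|].
Proof.
move=> n0.
have Cl0 : `[< is_clique g (finset.set0 : {set 'I_n}) >] by apply/asboolP => i j; rewrite inE.
case: (@arg_maxnP _ finset.set0 (fun S : {set 'I_n} => `[< is_clique g S >]) (fun S : {set 'I_n} => #|S|) Cl0).
move=> T /asboolP Tcl Tmax.
have Tmax' (S : {set 'I_n}) : is_clique g S -> #|S| <= #|T| by move=> /asboolP; apply: Tmax.
have T0 : 0 < #|T|.
  rewrite -(cards1 (Ordinal n0)); apply: Tmax' => i j; rewrite !inE => /eqP-> /eqP->.
  by rewrite eqxx.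
suff [Q QT [Qd Wd]] : exists2 Q : {set 'I_n}, Q \subset T & 0 < #|Q| <= 3 * r /\
    #|[set v | (v \notin T) && [forall q in Q, g v q]]%SET| <= 3 * r.
  have [qs [ws [sq sw cT]]] := clique_cand Tcl QT Qd Wd.
  by exists qs, ws; split=> //; rewrite cT.
have adjE u v : u \notin K -> g u v = adj E u v by apply: planted_out.
have [big|small] := leqP r #|T :&: K|.
  have [Q QTK Qr] := subset_of_card big.
  have /finset.subsetIP[QT QK] := QTK.
  exists Q => //; split; first by rewrite Qr r0; lia.
  set Z := [set v | (v \notin Q) && [forall a in Q, adj E v a]]%SET.
  have Zr : #|Z| < r := common_neighbors Qr.
  set W := [set v | _]%SET.
  (* [K] is a clique of the planted graph, so it is no larger than [T]. *)
  have KT : #|K :\: T| <= #|T :\: K|.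
    have : #|K| <= #|T|.
      apply: Tmax' => i j iK jK ij; by rewrite /g /planted ij iK jK orbT.
    by rewrite -(cardsID T K) -(cardsID K T) (finset.setIC T K) leq_add2l.
  have TKZ : T :\: K \subset Z.
    apply/fintype.subsetP => v; rewrite !inE => /andP[vK vT].
    have vQ : v \notin Q by apply: contra vK; apply: (fintype.subsetP QK).
    rewrite vQ; apply/forall_inP => q qQ; rewrite -adjE //.
    by apply: Tcl => //; [apply: (fintype.subsetP QT)|apply: contraNneq vQ => ->].
  (* A vertex of [W] outside [K] sees [Q] through edges of [G'], hence lies in [Z]. *)
  have WS : W \subset (K :\: T) :|: (Z :\: T).
    apply/fintype.subsetP => v; rewrite !inE => /andP[vT /forall_inP H]; rewrite vT /=.
    have [//|vK] /= := boolP (v \in K).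
    have vQ : v \notin Q by apply: contra vK; apply: (fintype.subsetP QK).
    by rewrite vQ; apply/forall_inP => q qQ; rewrite -adjE ?H.
  (* Hence [#|W| <= #|K :\: T| + #|Z :\: T| <= #|Z :&: T| + #|Z :\: T| = #|Z| < r]. *)
  have TZ : #|T :\: K| <= #|Z :&: T|.
    by apply: subset_leq_card; rewrite finset.subsetI TKZ finset.subsetDl.
  have := subset_leq_card WS; have := cardsID T Z; have := (leq_card_setU (K :\: T) (Z :\: T)).1.
  lia.
(* Two disjoint [r]-subsets of [T :\: K] would form a [K_{r,r}] in [G']. *)
have TK : #|T :\: K| < 2 * r.
  rewrite ltnNge; apply/negP => le2.
  have [|A /fintype.subsetP AT Ar] := @subset_of_card (T :\: K) r; first by lia.
  have [|B /fintype.subsetP BT Br] := @subset_of_card ((T :\: K) :\: A) r.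
    rewrite cardsD (_ : _ :&: A = A) ?Ar; first by lia.
    by apply/finset.setIidPr/fintype.subsetP.
  have [] := free Ar Br.
    rewrite disjoint_sym finset.disjoints_subset; apply/fintype.subsetP => v /BT; by rewrite !inE => /andP[].
  move=> a [b [aA bB]]; have := AT a aA; have := BT b bB; rewrite !inE.
  move=> /andP[bA /andP[bK bT]] /andP[aK aT]; rewrite -adjE // Tcl //.
  by apply: contraNneq bA => <-.
exists T => //; split; first by rewrite T0 /= -(cardsID K T); lia.
rewrite (_ : [set v | _]%SET = finset.set0) ?cards0 //.
apply/setP => v; rewrite !inE; apply/negbTE/negP => /andP[vT /forall_inP H].
(* A vertex seeing all of [T] would extend the maximum clique, so for [Q = T] nothing has to be
   excluded. *)
have : #|v |: T| <= #|T|.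
  apply: Tmax' => i j; rewrite !inE => /orP[/eqP->|iT] /orP[/eqP->|jT] ij.
  - by rewrite eqxx in ij.
  - exact: H.
  - by rewrite /g planted_sym; apply: H.
  - exact: Tcl.
by rewrite cardsU1 vT add1n ltnn.
Qed.

End Cliques.

(** * The random graph *)

Local Open Scope ring_scope.

Section Probability.

Variables (R : realType) (n : nat) (p : R).
Hypotheses (p0 : 0 <= p) (p1 : p <= 1).
Implicit Types (E F : {set upair n}) (A B : {set 'I_n}).

Lemma gnp_ge0 E : 0 <= gnp_prob p E.
Proof. by apply: prodr_ge0 => e _; case: ifP => _ //; rewrite subr_ge0. Qed.

(** Expanding the product of [p + (1 - p)] over all edges gives the sum over all [E]; replacing
    [1 - p] by 0 at the edges of [F] keeps just the terms with [F] inside [E]. *)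
Lemma gnp_superset F : \sum_(E : {set upair n} | F \subset E) gnp_prob p E = p ^+ #|F|.
Proof.
transitivity (\prod_(e : upair n) (p + (if e \in F then 0 else 1 - p))).
  rewrite bigA_distr big_mkcond; apply: eq_bigr => E _; rewrite /gnp_prob.
  case: ifP => [/fintype.subsetP FE|/negbT/subsetPn[e eF eE]].
    apply: eq_bigr => e _; case: ifP => // eE.
    by case: ifP => // /FE; rewrite eE.
  by apply/esym; rewrite (bigD1 e) //= (negPf eE) eF mul0r.
rewrite (eq_bigr (fun e => if e \in F then p else 1)) => [|e _]; last first.
  by case: ifP => _; rewrite ?addr0 // addrC subrK.
by rewrite -big_mkcond prodr_const.
Qed.

Lemma gnp_total : \sum_(E : {set upair n}) gnp_prob p E = 1.
Proof.
have := gnp_superset finset.set0; rewrite cards0 expr0 => <-.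
by apply: eq_bigl => E; rewrite finset.sub0set.
Qed.

Definition cross A B : {set upair n} :=
  [set e | ((val e).1 \in A) && ((val e).2 \in B) || ((val e).1 \in B) && ((val e).2 \in A)]%SET.

(** Orienting each edge so that it starts in [A] gives a map whose image contains all pairs from [A]
    and [B]. *)
Lemma card_cross A B : [disjoint A & B] -> (#|A| * #|B| <= #|cross A B|)%N.
Proof.
move=> /pred0P AB; rewrite -cardsX.
pose f (e : upair n) := if (val e).1 \in A then val e else ((val e).2, (val e).1).
apply: leq_trans (leq_imset_card f (cross A B)); apply: subset_leq_card.
apply/fintype.subsetP => -[a b]; rewrite inE /= => /andP[aA bB].
have bA : b \notin A by apply/negP => bA; have := AB b; rewrite /= bA bB.
have [ab|ba|/val_inj ab] := ltngtP a b.
- apply/imsetP; exists (exist _ (a, b) ab : upair n); first by rewrite inE /= aA bB.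
  by rewrite /f /= aA.
- apply/imsetP; exists (exist _ (b, a) ba : upair n); first by rewrite inE /= aA bB orbT.
  by rewrite /f /= (negPf bA).
- by rewrite -ab aA in bA.
Qed.

Lemma not_biclique_free r E : ~ biclique_free E r ->
  exists A B, [/\ #|A| = r, #|B| = r, [disjoint A & B] & cross A B \subset E].
Proof.
move=> nf; apply: contrapT => H; apply: nf => A B Ar Br AB.
apply: contrapT => H2; apply: H; exists A, B; split=> //.
have adjAB a b : a \in A -> b \in B -> adj E a b.
  by move=> aA bB; apply: contrapT => /negP nab; apply: H2; exists a, b; split.
have inE' (e : upair n) : adj E (val e).1 (val e).2 -> e \in E.
  case/existsP => e' /andP[e'E /orP[] /eqP e'e].
    by have <- : e' = e by apply: val_inj; rewrite e'e; case: (val e).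
  by have := valP e'; have := valP e; rewrite e'e /=; lia.
apply/fintype.subsetP => e; rewrite inE => /orP[] /andP[e1 e2]; apply: inE'.
  exact: adjAB.
by rewrite adj_sym; apply: adjAB.
Qed.

Lemma bin_le_exp m r : ('C(m, r) <= m ^ r)%N.
Proof.
apply: (@leq_trans (m ^_ r)); first by rewrite -bin_ffact leq_pmulr ?fact_gt0.
rewrite ffact_prod -[X in (_ <= _ ^ X)%N]card_ord -prod_nat_const.
by apply: leq_prod => i _; apply: leq_subr.
Qed.

(** Union bound over at most [n ^ (2 * r)] pairs of disjoint [r]-sets, each completely joined with
    probability at most [p ^ (r * r)]. *)
Lemma biclique_prob r :
  \sum_(E : {set upair n} | ~~ `[< biclique_free E r >]) gnp_prob p E
  <= n%:R ^+ (2 * r) * p ^+ (r * r).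
Proof.
pose D := [set X : {set 'I_n} | #|X| == r]%SET.
pose good (XY : {set 'I_n} * {set 'I_n}) :=
  [&& XY.1 \in D, XY.2 \in D & [disjoint XY.1 & XY.2]].
apply: (@le_trans _ _ (\sum_(XY | good XY) \sum_(E : {set upair n} | cross XY.1 XY.2 \subset E) gnp_prob p E)).
  (* After exchanging the sums, a graph with a biclique is counted for at least one pair. *)
  rewrite (exchange_big_dep predT) //= big_mkcond; apply: ler_sum => E _.
  case: ifP => [/asboolPn/not_biclique_free[A [B [Ar Br AB ABE]]]|_].
    have gAB : good (A, B) && (cross A B \subset E).
      by rewrite /good /= !inE Ar Br eqxx AB.
    rewrite (bigD1 (A, B)) //= lerDl; apply: sumr_ge0 => XY _; exact: gnp_ge0.
  by apply: sumr_ge0 => XY _; apply: gnp_ge0.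
apply: (@le_trans _ _ (\sum_(XY | good XY) p ^+ (r * r))).
  apply: ler_sum => -[A B] /and3P[/=]; rewrite !inE => /eqP Ar /eqP Br AB.
  rewrite gnp_superset; apply: ler_wiXn2l => //.
  by have := card_cross AB; rewrite Ar Br.
rewrite sumr_const -[_ *+ _]mulr_natl ler_wpM2r ?exprn_ge0 // -natrX ler_nat.
apply: (@leq_trans #|finset.setX D D|).
  by apply: subset_leq_card; apply/fintype.subsetP => -[A B] /and3P[/= AD BD _]; rewrite inE AD.
have cD : #|D| = 'C(n, r) by rewrite card_draws card_ord.
by rewrite cardsX cD mul2n -addnn expnD leq_mul // bin_le_exp.
Qed.

(** The machine can fail only on graphs containing a [K_{r,r}]. *)
Lemma success_bounds (M : TM) k r (strat : {set upair n} -> {set 'I_n}) :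
    (forall E, biclique_free E r -> succeeds M k strat E) ->
  1 - n%:R ^+ (2 * r) * p ^+ (r * r) <= success_prob M k p strat <= 1.
Proof.
move=> good; apply/andP; split; last first.
  rewrite -gnp_total; apply: ler_sum => E _; case: ifP => // _; exact: gnp_ge0.
rewrite lerBlDr; apply: (le_trans _ (lerD (lexx _) (biclique_prob r))).
rewrite -{1}gnp_total /success_prob [X in _ + X]big_mkcond -big_split /=.
apply: ler_sum => E _; have [bfE|_] /= := asboolP (biclique_free E r).
  by rewrite asboolT ?addr0 //; apply: good.
by rewrite lerDr; case: ifP => // _; apply: gnp_ge0.
Qed.

End Probability.

(** * Estimates for the edge density [n ^ (delta - 1)] *)

Section Asymptotics.

Variable R : realType.
Implicit Types (delta : R) (n r : nat).

Lemma natr_powR n (m : nat) : powR (n%:R : R) m%:R = n%:R ^+ m.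
Proof. exact: powR_mulrn. Qed.

Lemma edge_density_bounds delta n : delta < 1 -> 0 <= powR (n%:R : R) (delta - 1) <= 1.
Proof.
move=> d1; rewrite powR_ge0 /=; case: n => [|n].
  by rewrite powR0 // subr_eq0 lt_eqF.
rewrite -[X in _ <= X](powRr0 n.+1%:R); apply: ler_powR; first by rewrite ler1n.
by rewrite subr_le0 ltW.
Qed.

(** The exponent of [n] is [2 * r - (1 - delta) * r ^ 2], which is at most
    [2 * r - 3 * r = - r <= -1]. *)
Lemma union_bound_small delta n r : (0 < n)%N -> 3 <= (1 - delta) * r%:R -> (0 < r)%N ->
  n%:R ^+ (2 * r) * powR (n%:R : R) (delta - 1) ^+ (r * r) <= n%:R^-1.
Proof.
move=> n0 dr r0; have n1 : 1 <= n%:R :> R by rewrite ler1n.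
have nn : n%:R != 0 :> R by rewrite pnatr_eq0 -lt0n.
rewrite -natr_powR -powR_mulrn ?powR_ge0 // -powRrM -powRD; last by rewrite nn implybT.
rewrite -powR_inv1 //; apply: ler_powR => //.
rewrite !natrM; have r1 : 1 <= r%:R :> R by rewrite ler1n.
nra.
Qed.

End Asymptotics.

(** * Running time and success probability *)

Local Open Scope ring_scope.
Local Open Scope classical_set_scope.

Lemma card_head d : #|{: head d}| = (11 + 2 * d)%N.
Proof. by rewrite !card_sum !card_ord; lia. Qed.

Lemma machine_succeeds n k r (strat : {set upair n} -> {set 'I_n}) E :
  (0 < n)%N -> (0 < r)%N -> biclique_free E r -> succeeds (machine (3 * r)) k strat E.
Proof.
move=> n0 r0 free; set K := strat E.
have [t [cf [S [_ runE outE best]]]] := machine_spec (3 * r) k (planted_sym E K).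
have [qs [ws [sq sw [Cl Mx] c0]]] := max_clique_cand K r0 free n0.
have [ClS le] := best qs ws sq sw Cl c0.
exists t, cf, S; split=> //; split=> //; split=> // T /Mx Tle.
exact: leq_trans Tle le.
Qed.

(** For [0 < n] and [k <= n] the base [N + 3 = k + 4 + n ^ 2] is at most [6 * n ^ 2], and its
    exponent is [13 + 2 * d]. The additive [A] covers [n = 0]. *)
Lemma machine_time (R : realType) (delta : R) d n k (E : {set upair n}) :
    delta < 1 -> (k <= n)%N -> (26 + 4 * d)%:R <= 100 / (1 - delta) ->
  let A := ((algorithm_weight d + 2) * 6 ^ (13 + 2 * d))%N in
  exists t cf, t%:R <= A%:R * powR (n%:R : R) (100 / (1 - delta)) + A%:R /\
    run t (init (machine d) (enc_input k (adj E))) = Some cf.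
Proof.
move=> d1 kn dle A.
have [t [cf [_ [tle runE _ _]]]] := machine_spec d k (adj_sym E).
exists t, cf; split=> //.
rewrite card_head (_ : (11 + 2 * d + 2 = 13 + 2 * d)%N) in tle; last by lia.
case: (posnP n) => [n0|n0].
  rewrite -[X in X <= _]add0r lerD ?mulr_ge0 ?powR_ge0 // ler_nat.
  apply: leq_trans tle _; rewrite leq_mul2l; apply/orP; right.
  by rewrite leq_exp2r //; lia.
have n1 : 1 <= n%:R :> R by rewrite ler1n.
rewrite -[X in X <= _]addr0 lerD //.
apply: (@le_trans _ _ (A%:R * n%:R ^+ (26 + 4 * d))).
  rewrite -natrX -natrM ler_nat; apply: leq_trans tle _.
  rewrite /A -mulnA leq_mul2l (_ : (26 + 4 * d = 2 * (13 + 2 * d))%N); last by lia.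
  rewrite [(n ^ (2 * _))%N]expnM -expnMn leq_exp2r; last by lia.
  by apply/orP; right; nia.
by rewrite -natr_powR ler_wpM2l // ler_powR.
Qed.

Theorem theorem1p2 (R : realType) :
  exists C : R, 0 < C /\
  forall delta : R, 0 < delta < 1 ->
  forall k : nat -> nat, (forall n, (k n <= n)%N) ->
  exists (M : TM) (A : nat),
    (* running time n^{O(1/(1-delta))}, worst case over all input graphs *)
    (forall (n : nat) (E : {set upair n}),
       exists (t : nat) (cf : config M),
         (t%:R <= A%:R * powR (n%:R : R) (C / (1 - delta)) + A%:R) /\
         run t (init M (enc_input (k n) (adj E))) = Some cf) /\
    (* for every adversarial strategy, success w.h.p. when p = n^{delta-1} *)
    (forall strat : forall n : nat, {set upair n} -> {set 'I_n},
       (forall n (E : {set upair n}), #|strat n E| = k n) ->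
       (fun n : nat => success_prob M (k n) (powR (n%:R : R) (delta - 1)) (strat n))
         @ \oo --> (1 : R)).
Proof.
(* The degree is [26 + 4 * d] with [d = 3 * r] and [r <= 3 / (1 - delta) + 1], hence at most [38 +
   36 / (1 - delta) <= 74 / (1 - delta)]. *)
exists 100; split=> // delta /andP[d0 d1] k kn.
have e0 : 0 < 1 - delta by rewrite subr_gt0.
have y0 : 0 <= 3 / (1 - delta) by rewrite divr_ge0 // ltW.
pose r := (Num.trunc (3 / (1 - delta))).+1.
have r_ge : 3 <= (1 - delta) * r%:R.
  by rewrite mulrC -ler_pdivrMr // ltW // /r truncnS_gt.
have r_le : r%:R <= 3 / (1 - delta) + 1 by rewrite /r -natr1 lerD2r truncn_le.
(* The machine depends on [delta] alone; the value of [k] is read from the input. *)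
exists (machine (3 * r)), ((algorithm_weight (3 * r) + 2) * 6 ^ (13 + 2 * (3 * r)))%N.
split=> [n E|strat _].
  apply: machine_time => //; rewrite ler_pdivlMr // mulnA natrD natrM.
  have : r%:R * (1 - delta) <= 3 + (1 - delta).
    by rewrite -ler_pdivlMr // mulrDl divff ?gt_eqF.
  by move: d0; nra.
have inv_cvg : (fun n : nat => (n%:R : R)^-1) @ \oo --> (0 : R).
  by rewrite -cvg_shiftS; apply: cvg_harmonic.
have low_cvg : (fun n : nat => 1 - (n%:R : R)^-1) @ \oo --> (1 : R).
  by rewrite -[X in _ --> X]subr0; apply: cvgB => //; apply: cvg_cst.
apply: (@squeeze_cvgr _ _ _ _ _ (fun=> 1) _ _ _ low_cvg); last exact: cvg_cst.
near=> n.
have n0 : (0 < n)%N by near: n; exact: nbhs_infty_gt.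
have /andP[p0 p1] := edge_density_bounds n d1.
have /andP[lo ->] := success_bounds p0 p1 (fun E => @machine_succeeds n (k n) r (strat n) E n0 isT).
rewrite andbT; apply: le_trans lo; rewrite lerD2l lerN2.
exact: union_bound_small.
Unshelve. all: by end_near.
Qed.
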